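(* Let $f,f_1\colon(\mathbb{R}^n,0)\to(\mathbb{R}^m,0)$ be differentiable mappings, defined in a neighbourhood of $0$ with $f(0)=f_1(0)=0$, with locally Lipschitz differentials $df,df_1\colon(\mathbb{R}^n,0)\to L(\mathbb{R}^n,\mathbb{R}^m)$. Let $Z=\{x\in\mathbb{R}^n:\nu(df(x))=0\}$ and assume $0\in Z$. If there are constants $C,C_1,C_2>0$ with $C_2<\frac12$ such that $$\nu(df(x))\ge C\operatorname{dist}(x,Z),$$ $$|f(x)-f_1(x)|\le C_1\,\nu(df(x))^2,$$ $$\|df(x)-df_1(x)\|\le C_2\,\nu(df(x))$$ as $x\to0$, then the deformation $f+t(f_1-f)$ is topologically trivial near $Z$ along $[0,1]$. In particular, $f$ and $f_1$ are isotopical near $Z$ at zero.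
   Context: Notation. $F\colon(\mathbb{R}^n,a)\to\mathbb{R}^m$ denotes a mapping defined in a neighbourhood of $a$ with values in $\mathbb{R}^m$; one writes $F\colon(\mathbb{R}^n,a)\to(\mathbb{R}^m,b)$ if $F(a)=b$. $|\cdot|$ denotes a norm, $\|\cdot\|$ the norm of a linear mapping, $\operatorname{dist}(x,V)$ is the distance of $x$ to $V\subset\mathbb{R}^n$ (with $\operatorname{dist}(x,\emptyset)=1$). $df(x)\in L(\mathbb{R}^n,\mathbb{R}^m)$ is the differential of $f$ at $x$; the set $Z$ consists of points $x$ of the domain of $f$. An inequality ''as $x\to0$'' means that it holds for all $x$ in some neighbourhood of $0$. Rabier function. For real Banach spaces $X,Y$ and a continuous linear map $A\in L(X,Y)$ with adjoint $A^*\in L(Y',X')$ ($X',Y'$ the dual spaces), $\nu(A)=\inf\{\|A^*\varphi\|:\varphi\in Y',\ \|\varphi\|=1\}$. Isotopy. Let $\Omega\subset\mathbb{R}^n$ be a neighbourhood of $0$ and $0\in Z\subset\mathbb{R}^n$. A continuous mapping $H\colon\Omega\times[0,1]\to\mathbb{R}^n$, with $H_t(x)=H(x,t)$, is an isotopy near $Z$ at zero if (a) $H_0(x)=x$ for $x\in\Omega$, and $H_t(x)=x$ for $t\in[0,1]$, $x\in\Omega\cap Z$; (b) for every $t\in[0,1]$ the mapping $H_t$ is a homeomorphism onto $H_t(\Omega)$. Mappings $f\colon\Omega_1\to\mathbb{R}^m$ and $g\colon\Omega_2\to\mathbb{R}^m$, where $\Omega_1,\Omega_2$ are neighbourhoods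 of $0\in\mathbb{R}^n$, are isotopical near $Z$ at zero if there is an isotopy near $Z$ at zero $H\colon\Omega\times[0,1]\to\mathbb{R}^n$, $\Omega\subset\Omega_1\cap\Omega_2$, with $f(H_1(x))=g(x)$ for $x\in\Omega$. For $f\colon\Omega_1\to\mathbb{R}^m$ and $h\colon\Omega_3\to\mathbb{R}^m$, with $\Omega_1,\Omega_3$ neighbourhoods of $0\in\mathbb{R}^n$, the deformation $f+th$ is topologically trivial near $Z$ along $[0,1]$ if there is an isotopy near $Z$ at zero $H\colon\Omega\times[0,1]\to\mathbb{R}^n$, $\Omega\subset\Omega_1\cap\Omega_3$, such that $f(H(x,t))+t\,h(H(x,t))$ is defined for all $(x,t)\in\Omega\times[0,1]$ and does not depend on $t\in[0,1]$. *)

(* Defs.v *)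
From HB Require Import structures.
From mathcomp Require Import all_boot all_order all_algebra.
From mathcomp Require Import all_classical all_reals all_analysis.

Set Implicit Arguments.
Unset Strict Implicit.
Unset Printing Implicit Defensive.

Import Order.TTheory GRing.Theory Num.Theory.
Import numFieldTopology.Exports numFieldNormedType.Exports.

Local Open Scope classical_set_scope.
Local Open Scope ring_scope.

(* R^n is 'rV[R]_n.  Norms on R^n are explicit functions, so that they are not
   restricted to the max norm carried by 'rV[R]_n; the topology and the
   differential do not depend on the norm and are those of the library. *)
Definition is_norm (R : realType) (V : lmodType R) (N : V -> R) : Prop :=
  [/\ forall x y, N (x + y) <= N x + N y,
      forall (a : R) x, N (a *: x) = `|a| * N x
    & forall x, N x = 0 -> x = 0].

(* Operator norm of a linear map A for the norms N (source) and M (target);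
   using the closed unit ball keeps the set nonempty when V = 0. *)
Definition opnorm (R : realType) (V W : lmodType R) (N : V -> R) (M : W -> R)
    (A : V -> W) : R :=
  sup [set M (A v) | v in [set v | N v <= 1]].

Definition dualnorm (R : realType) (V : lmodType R) (N : V -> R)
    (phi : V -> R^o) : R :=
  opnorm N (fun r : R^o => `|r : R|) phi.

(* The adjoint of A sends phi to phi \o A. *)
Definition rabier (R : realType) (n m : nat) (N : 'rV[R]_n -> R)
    (M : 'rV[R]_m -> R) (A : 'rV[R]_n -> 'rV[R]_m) : R :=
  inf [set dualnorm N (phi \o A) | phi in
        [set phi : {linear 'rV[R]_m -> R^o} |
           continuous phi /\ dualnorm M phi = 1]].

Definition dist (R : realType) (n : nat) (N : 'rV[R]_n -> R)
    (x : 'rV[R]_n) (Z : set 'rV[R]_n) : R :=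
  if `[< Z = set0 >] then 1 else inf [set N (x - z) | z in Z].

Definition locally_lipschitz_diff (R : realType) (n m : nat)
    (N : 'rV[R]_n -> R) (M : 'rV[R]_m -> R) (U : set 'rV[R]_n)
    (f : 'rV[R]_n -> 'rV[R]_m) : Prop :=
  forall a, U a -> exists (L : R) (V : set 'rV[R]_n), nbhs a V /\
    forall x y, V x -> V y ->
      opnorm N M (fun v => 'd f x v - 'd f y v) <= L * N (x - y).

(* A map defined on a set D is a total function of which only the values on D
   are used. *)
Definition homeo_onto_image (R : realType) (n : nat) (D : set 'rV[R]_n)
    (h : 'rV[R]_n -> 'rV[R]_n) : Prop :=
  {within D, continuous h} /\
  exists g : 'rV[R]_n -> 'rV[R]_n,
    (forall x, D x -> g (h x) = x) /\ {within h @` D, continuous g}.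

Definition isotopy_near (R : realType) (n : nat) (Z Omega : set 'rV[R]_n)
    (H : 'rV[R]_n -> R -> 'rV[R]_n) : Prop :=
  [/\ nbhs (0 : 'rV[R]_n) Omega,
      {within Omega `*` `[0, 1]%classic,
         continuous (fun p : 'rV[R]_n * R => H p.1 p.2)},
      forall x, Omega x -> H x 0 = x,
      forall x t, (Omega `&` Z) x -> 0 <= t <= 1 -> H x t = x
    & forall t, 0 <= t <= 1 -> homeo_onto_image Omega (H ^~ t)].

(* The conditions on H x 1, and on H x t below, express that the compositions
   with f and h are defined. *)
Definition isotopical_near (R : realType) (n m : nat) (Z : set 'rV[R]_n)
    (U1 : set 'rV[R]_n) (f : 'rV[R]_n -> 'rV[R]_m)
    (U2 : set 'rV[R]_n) (g : 'rV[R]_n -> 'rV[R]_m) : Prop :=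
  exists (Omega : set 'rV[R]_n) (H : 'rV[R]_n -> R -> 'rV[R]_n),
    [/\ isotopy_near Z Omega H,
        Omega `<=` U1 `&` U2,
        forall x, Omega x -> U1 (H x 1)
      & forall x, Omega x -> f (H x 1) = g x].

Definition topologically_trivial_near (R : realType) (n m : nat)
    (Z : set 'rV[R]_n)
    (U1 : set 'rV[R]_n) (f : 'rV[R]_n -> 'rV[R]_m)
    (U3 : set 'rV[R]_n) (h : 'rV[R]_n -> 'rV[R]_m) : Prop :=
  exists (Omega : set 'rV[R]_n) (H : 'rV[R]_n -> R -> 'rV[R]_n),
    [/\ isotopy_near Z Omega H,
        Omega `<=` U1 `&` U3,
        forall x t, Omega x -> 0 <= t <= 1 -> (U1 `&` U3) (H x t)
      & forall x t s, Omega x -> 0 <= t <= 1 -> 0 <= s <= 1 ->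
          f (H x t) + t *: h (H x t) = f (H x s) + s *: h (H x s)].

(* Main.v *)
Require Import Defs.
From HB Require Import structures.
From mathcomp Require Import all_boot all_order all_algebra.
From mathcomp Require Import all_classical all_reals all_analysis.
From mathcomp Require Import ring lra.

Set Implicit Arguments.
Unset Strict Implicit.
Unset Printing Implicit Defensive.

Import Order.TTheory GRing.Theory Num.Theory.
Import numFieldTopology.Exports numFieldNormedType.Exports.

Local Open Scope classical_set_scope.
Local Open Scope ring_scope.

(** The isotopy is the flow of a time dependent vector field that lifts the
    deformation.  Write [A x t] for the matrix of [df x + t (df1 x - df x)] and
    [h = f1 - f].  If [W x t] satisfies [W x t *m A x t + h x = 0], then
    [f + t h] is constant along the integral curves of [W].  Where
    [nu = rabier N M ('d f x)] is positive, the bound [C2 < 1/2] keeps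
    [rabier N M (A x t)] above [nu / 2], because [rabier] is 1-Lipschitz for the
    operator norm ([rabier_lipschitz]); hence [A x t] is onto, and [W x t] is
    taken to be the solution of least Euclidean norm ([lnsol]).  On [Z] the
    remainder [h] vanishes and [W] is set to [0].

    Everything rests on the fact that [W] is Lipschitz up to and including [Z]
    ([lifting_field_lipschitz]).  A right inverse of [A x t] has size [1 / nu]
    and a derivative of size [1 / nu ^ 2], while [h] has size [nu ^ 2] and a
    derivative of size [nu], so that the products are bounded.  Since [nu] is
    itself Lipschitz, two points [x], [y] either have comparable values of [nu],
    in which case this computation applies ([lnsol_diff]), or satisfy
    [nu x + nu y = O(|x - y|)], in which case [|W| = O(nu)] is enough.

    After clamping coordinates and time, [W] becomes a bounded field that is
    Lipschitz on the whole space; Picard iteration ([solution_exists]) gives its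
    flow and a Gronwall estimate in both time directions ([gronwall]) shows that
    each flow map is bi-Lipschitz, hence a homeomorphism onto its image.  Points
    of [Z] are stationary, and comparison with the stationary point [0] keeps
    the curves that start near [0] inside the cube where the estimates hold
    ([isotopy_of_field]).  The field [- W x (1 - t)] gives in the same way a
    flow that carries [f1] back to [f], which is the second assertion. *)

(** * Lipschitz maps and the max norm *)

Lemma within_lipschitz_continuous (R : realType) (V W : normedModType R)
    (A : set V) (f : V -> W) (K : R) :
  (forall x y, A x -> A y -> `|f x - f y| <= K * `|x - y|) ->
  {within A, continuous f}.
Proof.
move=> h; apply/subspace_continuousP => x Ax; apply/cvgrPdist_le => /= e e0.
have K0 : 0 < `|K| + 1 by rewrite ltr_wpDl.
apply/nbhs_ballP; exists (e / (`|K| + 1)); first by rewrite /= divr_gt0.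
move=> y + Ay; rewrite -ball_normE /= ltr_pdivlMr// => /ltW hy.
rewrite (le_trans (h x y Ax Ay))// (le_trans _ hy)// mulrC ler_wpM2l//.
by rewrite (le_trans (ler_norm K))// lerDl.
Qed.

Lemma lipschitz_continuous (R : realType) (V W : normedModType R) (f : V -> W)
    (K : R) :
  (forall x y, `|f x - f y| <= K * `|x - y|) -> continuous f.
Proof.
move=> h; apply/continuous_subspace_setT.
by apply: (@within_lipschitz_continuous _ _ _ _ _ K) => x y _ _; exact: h.
Qed.

Section MaxNorm.
Context {R : realType}.

Lemma mx_coord_le m n (A : 'M[R]_(m, n)) i j : `|A i j| <= `|A|.
Proof.
rewrite [leRHS]/Num.Def.normr/= mx_normrE.
exact: (le_bigmax _ (fun ij => `|A ij.1 ij.2|) (i, j)).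
Qed.

Lemma mx_norm_le m n (A : 'M[R]_(m, n)) (a : R) :
  0 <= a -> (forall i j, `|A i j| <= a) -> `|A| <= a.
Proof.
move=> a0 h; rewrite [leLHS]/Num.Def.normr/= mx_normrE.
by apply: bigmax_le => // -[i j] _; exact: h.
Qed.

Lemma mulmx_norm_le p m n (A : 'M[R]_(p, m)) (B : 'M[R]_(m, n)) :
  `|A *m B| <= m%:R * `|A| * `|B|.
Proof.
apply: mx_norm_le => [|i j]; first by rewrite !mulr_ge0.
rewrite mxE (le_trans (ler_norm_sum _ _ _))//.
have -> : m%:R * `|A| * `|B| = \sum_(k < m) `|A| * `|B|.
  by rewrite sumr_const card_ord -mulrA mulr_natl.
apply: ler_sum => k _; rewrite normrM.
by apply: ler_pM => //; exact: mx_coord_le.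
Qed.

Lemma trmx_norm m n (A : 'M[R]_(m, n)) : `|A^T| = `|A|.
Proof.
apply/eqP; rewrite eq_le; apply/andP; split; apply: mx_norm_le => // i j.
  by rewrite mxE mx_coord_le.
by have := mx_coord_le A^T j i; rewrite mxE.
Qed.

Definition dot n (u v : 'rV[R]_n) : R := (u *m v^T) 0 0.

Lemma dot_le n (u v : 'rV[R]_n) : `|dot u v| <= n%:R * `|u| * `|v|.
Proof.
by rewrite (le_trans (mx_coord_le _ _ _))// -(trmx_norm v) mulmx_norm_le.
Qed.

Lemma sqr_norm_le_dot n (u : 'rV[R]_n) : `|u| ^+ 2 <= dot u u.
Proof.
have d0 : 0 <= dot u u.
  by rewrite /dot mxE sumr_ge0// => i _; rewrite mxE -expr2 sqr_ge0.
rewrite -(ler_pXn2r (_ : 0 < 1)%N) ?nnegrE ?exprn_ge0 ?expr1//.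
rewrite -[leRHS]sqr_sqrtr// ler_pXn2r ?nnegrE ?sqrtr_ge0//.
apply: mx_norm_le => [|i j]; rewrite ?sqrtr_ge0//.
rewrite -(ler_pXn2r (_ : 0 < 2)%N) ?nnegrE ?sqrtr_ge0// sqr_sqrtr//.
rewrite real_normK ?num_real// /dot mxE (bigD1 j)//= (ord1 i) mxE -expr2 lerDl.
by rewrite sumr_ge0// => k _; rewrite mxE -expr2 sqr_ge0.
Qed.

End MaxNorm.

(** * Norms on row vectors and operator norms *)

Section Norms.
Context {R : realType}.

Lemma is_norm0 (V : lmodType R) (N : V -> R) : is_norm N -> N 0 = 0.
Proof. by case=> _ h _; rewrite -(scale0r 0) h normr0 mul0r. Qed.

Lemma is_norm_ge0 (V : lmodType R) (N : V -> R) x : is_norm N -> 0 <= N x.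
Proof.
move=> hN; case: (hN) => tri hom _.
have := tri x (-1 *: x); rewrite hom normrN1 mul1r scaleN1r subrr is_norm0//.
by move=> h; lra.
Qed.

Lemma is_norm_abs : is_norm (fun r : R^o => `|r : R|).
Proof.
split=> [x y|a x|x]; [exact: ler_normD|exact: normrM|].
by move/eqP; rewrite normr_eq0 => /eqP.
Qed.

Lemma is_norm_gt0 (V : lmodType R) (N : V -> R) x :
  is_norm N -> x != 0 -> 0 < N x.
Proof.
move=> hN; rewrite lt_def is_norm_ge0// andbT; apply: contra_neq => h.
by case: hN => _ _; apply.
Qed.

Lemma linear_bounded_max n (W : lmodType R) (M : W -> R)
    (A : {linear 'rV[R]_n -> W}) : is_norm M ->
  exists2 b, 0 < b & forall v, M (A v) <= b * `|v|.
Proof.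
move=> hM; case: (hM) => tri hom _.
have s0 : 0 <= \sum_(j < n) M (A (delta_mx 0 j)).
  by rewrite sumr_ge0// => j _; exact: is_norm_ge0.
exists (1 + \sum_(j < n) M (A (delta_mx 0 j))); first by lra.
move=> v; rewrite mulrDl mul1r ler_wpDl//.
rewrite {1}(row_sum_delta v) linear_sum/=.
have : M (\sum_(j < n) A (v 0 j *: delta_mx 0 j))
      <= \sum_(j < n) M (A (v 0 j *: delta_mx 0 j)).
  elim/big_ind2 : _ => //[|x a y b xa yb]; first by rewrite is_norm0.
  by rewrite (le_trans (tri _ _))// lerD.
move=> /le_trans; apply; rewrite mulr_suml; apply: ler_sum => j _.
by rewrite linearZ/= hom mulrC ler_wpM2l ?is_norm_ge0// mx_coord_le.
Qed.

Lemma norm_le_max n (N : 'rV[R]_n -> R) : is_norm N ->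
  exists2 b, 0 < b & forall v, N v <= b * `|v|.
Proof. exact: (linear_bounded_max idfun). Qed.

(** A norm is Lipschitz for the max norm, hence attains a positive minimum on
    the compact unit sphere; homogeneity does the rest. *)
Lemma max_le_norm n (N : 'rV[R]_n -> R) : is_norm N ->
  exists2 b, 0 < b & forall v, `|v| <= b * N v.
Proof.
move=> hN; have [K K0 hK] := norm_le_max hN; case: (hN) => tri hom _.
have cN : continuous N.
  apply: (@lipschitz_continuous _ _ _ _ K) => x y.
  have h a b : N a - N b <= K * `|a - b|.
    rewrite lerBlDr (le_trans _ (lerD (hK _) (lexx _)))//.
    by rewrite (le_trans _ (tri _ _))// subrK.
  by rewrite ler_norml lerNl opprB h andbT distrC h.
pose S := [set v : 'rV[R]_n | `|v| = 1].
have [S0|S0] := pselect (S !=set0); last first.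
  exists 1 => // v; have [->|v0] := eqVneq v 0; first by rewrite normr0 is_norm0// mulr0.
  exfalso; apply: S0; exists (`|v|^-1 *: v); rewrite /S/= normrZ normfV normr_id mulVf//.
  by rewrite normr_eq0.
have cS : compact S.
  apply: bounded_closed_compact.
    by exists 1; split => //= M M1 v /= ->; exact: ltW.
  have -> : S = (fun v => `|v|) @^-1` [set 1] by [].
  by apply: closed_comp => [v _|]; [exact: norm_continuous|exact: closed_eq].
have [c cS1 hc] := EVT_min_rV S0 cS (continuous_subspaceT cN).
have {}cS1 : `|c| = 1 by move: cS1; rewrite inE.
have c0 : c != 0 by rewrite -normr_eq0 cS1 oner_eq0.
exists (N c)^-1; first by rewrite invr_gt0 is_norm_gt0.
move=> v; have [->|v0] := eqVneq v 0; first by rewrite normr0 is_norm0// mulr0.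
have nv : 0 < `|v| by rewrite normr_gt0.
rewrite ler_pdivlMl ?is_norm_gt0//.
have := hc (`|v|^-1 *: v); rewrite inE hom normfV normr_id.
rewrite ler_pdivlMl// mulrC; apply.
by rewrite /S/= normrZ normfV normr_id mulVf// normr_eq0.
Qed.

Section Opnorm.
Context {V W : lmodType R} {N : V -> R} {M : W -> R}.
Hypotheses (hN : is_norm N) (hM : is_norm M).

Lemma opnorm_le (A : V -> W) b :
  (forall v, N v <= 1 -> M (A v) <= b) -> opnorm N M A <= b.
Proof.
move=> h; apply: ge_sup.
  by exists (M (A 0)), 0 => //=; rewrite is_norm0.
by move=> _ [v /= v1 <-]; exact: h.
Qed.

(** The supremum that defines [opnorm] means something only for a bounded set,
    which is what [b] provides. *)
Lemma opnorm_ub (A : {linear V -> W}) b : 0 <= b ->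
  (forall v, M (A v) <= b * N v) -> forall v, M (A v) <= opnorm N M A * N v.
Proof.
move=> b0 h v; have [->|v0] := eqVneq v 0.
  by rewrite linear0 (is_norm0 hN) (is_norm0 hM) mulr0.
have nv := is_norm_gt0 hN v0.
have homN := let: And3 _ h _ := hN in h; have homM := let: And3 _ h _ := hM in h.
rewrite mulrC -ler_pdivrMl//.
have -> : (N v)^-1 * M (A v) = M (A ((N v)^-1 *: v)).
  by rewrite linearZ/= homM gtr0_norm// invr_gt0.
apply: ub_le_sup; last first.
  exists ((N v)^-1 *: v) => //=.
  by rewrite homN gtr0_norm ?invr_gt0// mulVf// gt_eqF.
exists b => _ [w /= w1 <-]; rewrite (le_trans (h w))//.
by rewrite ler_piMr.
Qed.

Lemma opnorm_ge0 (A : V -> W) : 0 <= opnorm N M A.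
Proof.
rewrite /opnorm; set S := [set _ | _ in _].
have S0 : S (M (A 0)) by exists 0 => //=; rewrite is_norm0.
have [[_ hb]|hs] := pselect (has_sup S); last by rewrite sup_out.
exact: (le_trans (is_norm_ge0 (A 0) hM) (ub_le_sup hb S0)).
Qed.

End Opnorm.

Lemma linear_bounded n (N : 'rV[R]_n -> R) (W : lmodType R) (M : W -> R)
    (A : {linear 'rV[R]_n -> W}) : is_norm N -> is_norm M ->
  exists2 b, 0 <= b & forall v, M (A v) <= b * N v.
Proof.
move=> hN hM; have [b b0 hb] := linear_bounded_max A hM.
have [k k0 hk] := max_le_norm hN.
exists (b * k); first by rewrite mulr_ge0// ltW.
by move=> v; rewrite (le_trans (hb v))// -mulrA ler_wpM2l// ltW.
Qed.

Lemma opnorm_ub_rV n (N : 'rV[R]_n -> R) (W : lmodType R) (M : W -> R)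
    (A : {linear 'rV[R]_n -> W}) v : is_norm N -> is_norm M ->
  M (A v) <= opnorm N M A * N v.
Proof.
move=> hN hM; have [b b0 hb] := linear_bounded A hN hM.
exact: opnorm_ub b0 hb v.
Qed.

End Norms.

(** * The Rabier function *)

Section Rabier.
Context {R : realType} {n m : nat} {N : 'rV[R]_n -> R} {M : 'rV[R]_m -> R}.
Hypotheses (hN : is_norm N) (hM : is_norm M).
Local Notation nu A := (rabier N M (mulmxr A)).
Local Notation onm A := (opnorm N M (mulmxr A)).

Lemma opnorm_mulmxrZ a (A : 'M[R]_(n, m)) : onm (a *: A) <= `|a| * onm A.
Proof.
apply: opnorm_le => // v v1; rewrite /= -scalemxAr.
have -> : M (a *: (v *m A)) = `|a| * M (mulmxr A v) by case: hM => _ ->.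
rewrite ler_wpM2l// (le_trans (opnorm_ub_rV (mulmxr _) _ hN hM))// ler_piMr//.
exact: opnorm_ge0.
Qed.

Lemma opnorm_mulmxr_ge0 (A : 'M[R]_(n, m)) : 0 <= onm A.
Proof. exact: opnorm_ge0. Qed.

Lemma max_le_opnorm_mulmxr : exists2 b, 0 < b &
  forall A : 'M[R]_(n, m), `|A| <= b * onm A.
Proof.
have [k k0 hk] := max_le_norm hM; have [b b0 hb] := norm_le_max hN.
exists (k * b); first by rewrite mulr_gt0.
move=> A; apply: mx_norm_le => [|i j].
  by rewrite !mulr_ge0 ?opnorm_mulmxr_ge0// ltW.
have -> : A i j = (delta_mx 0 i *m A : 'rV_m) 0 j by rewrite -rowE mxE.
rewrite (le_trans (mx_coord_le _ _ _))// (le_trans (hk _))// -mulrA.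
rewrite ler_wpM2l ?(ltW k0)//.
rewrite (le_trans (opnorm_ub_rV (mulmxr A) (delta_mx 0 i) hN hM))//.
rewrite mulrC ler_wpM2r ?opnorm_mulmxr_ge0// (le_trans (hb _))// ler_piMr ?(ltW b0)//.
apply: mx_norm_le => // p q; rewrite mxE; case: (_ && _) => /=.
  by rewrite normr1.
by rewrite normr0.
Qed.

Lemma rabier_ge0 (A : 'M[R]_(n, m)) : 0 <= nu A.
Proof.
rewrite /rabier; set S := [set _ | _ in _].
have [S0|/set0P/negP] := pselect (S !=set0).
  by apply: lb_le_inf => // _ [phi _ <-]; exact: (opnorm_ge0 hN is_norm_abs).
by rewrite negbK => /eqP ->; rewrite inf0.
Qed.

(** The dual norms of the pullbacks of a unit form by [A] and by [B] differ by at
    most the operator norm of [A - B].  For [m = 0] there is no unit form and both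
    infima take the default value [0]. *)
Lemma rabier_lipschitz (A B : 'M[R]_(n, m)) : nu A <= nu B + onm (A - B).
Proof.
rewrite {1 2}/rabier.
set S := [set phi : {linear 'rV[R]_m -> R^o} | _].
have [[phi0 Sphi0]|/set0P/negP] := pselect (S !=set0); last first.
  by rewrite negbK => /eqP ->; rewrite !image_set0 inf0 add0r opnorm_mulmxr_ge0.
rewrite -lerBlDr; apply: lb_le_inf; first by exists (dualnorm N (phi0 \o mulmxr B)), phi0.
move=> _ [phi [cphi phi1] <-]; rewrite lerBlDr.
apply: (@le_trans _ _ (dualnorm N (phi \o mulmxr A))).
  apply: ge_inf; last by exists phi.
  by exists 0 => _ [psi _ <-]; exact: (opnorm_ge0 hN is_norm_abs).
apply: (opnorm_le hN) => v v1.
have -> : (phi \o mulmxr A) v = (phi \o mulmxr B) v + phi (mulmxr (A - B) v).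
  by rewrite /= -linearD/= mulmxBr addrC subrK.
rewrite (le_trans (ler_normD _ _))// lerD//.
  have := opnorm_ub_rV (phi \o mulmxr B) v hN is_norm_abs => /le_trans; apply.
  by rewrite ler_piMr// (opnorm_ge0 hN is_norm_abs).
have := opnorm_ub_rV phi (mulmxr (A - B) v) hM is_norm_abs => /le_trans; apply.
rewrite [opnorm _ _ _]phi1 mul1r.
by rewrite (le_trans (opnorm_ub_rV (mulmxr _) _ hN hM))// ler_piMr// opnorm_mulmxr_ge0.
Qed.

(** The pullback by [A] of the form [w |-> dot w g] is [v |-> dot v (g *m A^T)].
    After normalising the form, [rabier] bounds the dual norm of this pullback
    from below, and the equivalence of norms passes to max norms.  So a positive
    [rabier] makes [g |-> g *m A^T] injective, that is, [A] onto. *)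
Lemma rabier_coercive : exists2 c, 0 < c &
  forall (A : 'M[R]_(n, m)) (g : 'rV[R]_m), c * nu A * `|g| <= `|g *m A^T|.
Proof.
have [k k0 hk] := max_le_norm hN; have [b b0 hb] := norm_le_max hM.
have n1 : 0 < n%:R + 1 :> R by rewrite ltr_wpDl.
exists ((n%:R + 1) * k * b)^-1; first by rewrite invr_gt0 !mulr_gt0.
move=> A g; rewrite -mulrA ler_pdivrMl; last by rewrite !mulr_gt0.
have [->|g0] := eqVneq g 0.
  by rewrite mul0mx !normr0 !mulr0.
have fl (u : 'rV[R]_m) : linear (fun w => dot w u : R^o).
  by move=> a x y; rewrite /dot mulmxDl -scalemxAl !mxE.
pose F u : {linear 'rV[R]_m -> R^o} := HB.pack (fun w => dot w u : R^o)
  (GRing.isLinear.Build _ _ _ _ (fun w => dot w u : R^o) (fl u)).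
have FE u : F u = (fun w => dot w u : R^o) :> (_ -> _) by [].
have cF u : continuous (F u : _ -> R^o).
  apply: (@lipschitz_continuous _ _ _ _ (m%:R * `|u|)) => x y.
  by rewrite -linearB FE (le_trans (dot_le _ _))// mulrAC.
pose d := dualnorm M (F g).
have g0' : 0 < `|g| by rewrite normr_gt0.
have dge : `|g| <= b * d.
  have := opnorm_ub_rV (F g) g hM is_norm_abs; rewrite -/(dualnorm M (F g)) -/d FE.
  move=> h; have h2 := sqr_norm_le_dot g.
  have d0 : 0 <= d by exact: (opnorm_ge0 hM is_norm_abs).
  have h3 := ler_norm (dot g g); have h4 := ler_wpM2l d0 (hb g).
  by rewrite -(ler_pM2l g0') -expr2; lra.
have d0 : 0 < d by rewrite -(pmulr_rgt0 _ b0) (lt_le_trans g0').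
have FZ a u w : F (a *: u) w = a * F u w :> R.
  by rewrite !FE /dot linearZ/= -scalemxAr mxE.
have F1 : dualnorm M (F (d^-1 *: g)) = 1.
  apply/eqP; rewrite eq_le; apply/andP; split.
    apply: (opnorm_le hM) => v v1; rewrite FZ normrM gtr0_norm ?invr_gt0//.
    rewrite ler_pdivrMl// (le_trans (opnorm_ub_rV (F g) v hM is_norm_abs))//.
    rewrite ler_wpM2l//; exact: ltW.
  rewrite -(ler_pM2l d0) mulr1; apply: (opnorm_le hM) => v v1.
  have -> : (F g v : R) = d * F (d^-1 *: g) v by rewrite FZ mulrA mulfV ?mul1r// gt_eqF.
  rewrite normrM gtr0_norm// ler_pM2l//.
  rewrite (le_trans (opnorm_ub_rV (F (d^-1 *: g)) v hM is_norm_abs))// ler_piMr//.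
  exact: (opnorm_ge0 hM is_norm_abs).
have h1 : nu A <= dualnorm N (F (d^-1 *: g) \o mulmxr A).
  apply: ge_inf; last by exists (F (d^-1 *: g)).
  by exists 0 => _ [psi _ <-]; exact: (opnorm_ge0 hN is_norm_abs).
have h2 : dualnorm N (F (d^-1 *: g) \o mulmxr A) <= (n%:R + 1) * k * `|g *m A^T| / d.
  apply: (opnorm_le hN) => v v1; 
  have -> : ((F (d^-1 *: g) \o mulmxr A) v : R) = d^-1 * F g (v *m A) by exact: FZ.
  rewrite normrM.
  rewrite gtr0_norm ?invr_gt0// mulrC ler_wpM2r ?invr_ge0 ?(ltW d0)//.
  have -> : (F g (v *m A) : R) = dot v (g *m A^T).
    by rewrite FE /dot trmx_mul trmxK mulmxA.
  rewrite (le_trans (dot_le _ _))// ler_wpM2r//.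
  rewrite ler_pM//; first by rewrite lerDl.
  by rewrite (le_trans (hk v))// ler_piMr// ltW.
have h3 : nu A * d <= (n%:R + 1) * k * `|g *m A^T|.
  by rewrite -ler_pdivlMr// (le_trans h1).
rewrite (@le_trans _ _ (nu A * (b * d)))//; first by rewrite ler_wpM2l ?rabier_ge0.
have := ler_wpM2l (ltW b0) h3.
rewrite mulrCA => /le_trans; apply; rewrite le_eqVlt; apply/orP; left; apply/eqP; ring.
Qed.

End Rabier.

(** * Solutions of least Euclidean norm *)

Section LeastNorm.
Context {R : realType} {n m : nat}.
Implicit Types (A B : 'M[R]_(n, m)) (h g : 'rV[R]_m) (b : R).

Lemma dotDl k (u v w : 'rV[R]_k) : dot (u + v) w = dot u w + dot v w.
Proof. by rewrite /dot mulmxDl mxE. Qed.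

Lemma dot_mulmxr k l (u : 'rV[R]_k) (A : 'M[R]_(k, l)) v :
  dot (u *m A) v = dot u (v *m A^T).
Proof. by rewrite /dot trmx_mul trmxK mulmxA. Qed.

Lemma le_of_sqr_le (p x : R) : 0 <= p -> 0 <= x -> p ^+ 2 <= x * p -> p <= x.
Proof.
move=> p0 x0; rewrite expr2 => h; case: (eqVneq p 0) => [->//|pn].
by rewrite -(ler_pM2r (_ : 0 < p)) ?lt_def ?pn.
Qed.

(** When [A] is onto, [lnsol A h] is the solution [v] of [v *m A = h] of least
    Euclidean norm, that is, [h] times the Moore-Penrose inverse of [A], and
    [lnmult A h] is the Lagrange multiplier of this minimisation. *)
Definition lnmult A h : 'rV[R]_m := h *m invmx (A^T *m A).

Definition lnsol A h : 'rV[R]_n := lnmult A h *m A^T.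

Definition coercive b A := forall g, `|g| <= b * `|g *m A^T|.

(** If [g *m (A^T *m A) = 0], then pairing with [g] gives [g *m A^T = 0]. *)
Lemma gram_unit b A : coercive b A -> A^T *m A \in unitmx.
Proof.
move=> hA; rewrite -row_free_unit -kermx_eq0; apply/rowV0P => g /sub_kermxP gG.
have : dot (g *m A^T) (g *m A^T) = 0.
  by rewrite dot_mulmxr trmxK -mulmxA gG /dot trmx0 mulmx0 mxE.
move=> d0; have := sqr_norm_le_dot (g *m A^T); rewrite d0.
move=> h; have {}h : `|g *m A^T| = 0.
  by apply/eqP; rewrite -sqrf_eq0 eq_le h/= exprn_ge0.
by apply/eqP; rewrite -normr_le0 (le_trans (hA g))// h mulr0.
Qed.

Lemma lnmultK b A h : coercive b A -> lnmult A h *m (A^T *m A) = h.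
Proof. by move=> hA; rewrite -mulmxA mulVmx ?mulmx1//; exact: gram_unit hA. Qed.

Lemma lnsolK b A h : coercive b A -> lnsol A h *m A = h.
Proof. by move=> hA; rewrite -mulmxA (lnmultK _ hA). Qed.

Lemma dot_gram A g : dot (g *m A^T) (g *m A^T) = dot (g *m (A^T *m A)) g.
Proof. by rewrite mulmxA [RHS]dot_mulmxr. Qed.

(** The square of the solution is the pairing of [h] with the multiplier, which
    coercivity bounds by [b] times the solution. *)
Lemma lnsol_le b A h : 0 <= b -> coercive b A ->
  `|lnsol A h| <= m%:R * b * `|h|.
Proof.
move=> b0 hA; apply: le_of_sqr_le; rewrite ?mulr_ge0//.
rewrite (le_trans (sqr_norm_le_dot _))// dot_gram (lnmultK _ hA).
rewrite (le_trans (ler_norm _))// (le_trans (dot_le _ _))//.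
have -> : m%:R * b * `|h| * `|lnsol A h| = m%:R * `|h| * (b * `|lnsol A h|) by ring.
by rewrite ler_wpM2l ?mulr_ge0//; exact: hA.
Qed.

Lemma lnmult_le b A h : 0 <= b -> coercive b A ->
  `|lnmult A h| <= m%:R * b ^+ 2 * `|h|.
Proof.
move=> b0 hA; rewrite (le_trans (hA _))//.
have -> : m%:R * b ^+ 2 * `|h| = b * (m%:R * b * `|h|) by ring.
by rewrite ler_wpM2l//; exact: lnsol_le.
Qed.

(** The difference [d] of the multipliers solves a Gram equation for [A]; pairing
    it with [d] bounds [d *m A^T] directly.  Bounding [d] first and multiplying by
    [A^T] afterwards would cost one more factor [b], and [b] is of order [1 / nu]
    in the application. *)
Lemma lnsol_diff b A B h k : 0 <= b -> coercive b A -> coercive b B ->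
  `|lnsol A h - lnsol B k| <=
  m%:R * b * `|h - k| + m%:R ^+ 2 * (2 * n%:R + 1) * b ^+ 2 * `|A - B| * `|k|.
Proof.
move=> b0 hA hB; set gB := lnmult B k; set d := lnmult A h - gB.
set p := `|d *m A^T|; set e := `|A - B|.
have split : lnsol A h - lnsol B k = d *m A^T + gB *m (A - B)^T.
  by rewrite /d mulmxBl linearB/= mulmxBr addrA subrK.
have dG : d *m (A^T *m A) =
    (h - k) + lnsol B k *m (B - A) + gB *m (B - A)^T *m A.
  have -> : lnsol B k *m (B - A) = k - lnsol B k *m A.
    by rewrite mulmxBr (lnsolK _ hB).
  have -> : gB *m (B - A)^T *m A = lnsol B k *m A - gB *m (A^T *m A).
    by rewrite linearB/= mulmxBr mulmxBl -(mulmxA gB A^T).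
  by rewrite /d mulmxBl (lnmultK _ hA) !addrA !subrK.
have wB := lnsol_le k b0 hB; have gBle := lnmult_le k b0 hB.
have BA : `|B - A| = e by rewrite distrC.
have dle : `|d| <= b * p by exact: hA.
have p0 : 0 <= p by exact: normr_ge0.
have e0 : 0 <= e by exact: normr_ge0.
have m0 : 0 <= m%:R :> R by []; have n0 : 0 <= n%:R :> R by [].
have k0 : 0 <= `|k| by []; have hk0 : 0 <= `|h - k| by [].
have t1 : dot (h - k) d <= m%:R * b * `|h - k| * p.
  rewrite (le_trans (ler_norm _))// (le_trans (dot_le _ _))//.
  have -> : m%:R * b * `|h - k| * p = m%:R * `|h - k| * (b * p) by ring.
  by rewrite ler_wpM2l ?mulr_ge0.
have t2 : dot (lnsol B k *m (B - A)) d <= m%:R ^+ 2 * n%:R * b ^+ 2 * e * `|k| * p.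
  rewrite (le_trans (ler_norm _))// (le_trans (dot_le _ _))//.
  have -> : m%:R ^+ 2 * n%:R * b ^+ 2 * e * `|k| * p =
            m%:R * (n%:R * (m%:R * b * `|k|) * e) * (b * p) by ring.
  apply: ler_pM; rewrite ?mulr_ge0// ler_wpM2l//.
  rewrite (le_trans (mulmx_norm_le _ _))// BA ler_wpM2r// ler_wpM2l//.
have t3 : dot (gB *m (B - A)^T *m A) d <= m%:R ^+ 2 * n%:R * b ^+ 2 * e * `|k| * p.
  rewrite dot_mulmxr (le_trans (ler_norm _))// (le_trans (dot_le _ _))//.
  have -> : m%:R ^+ 2 * n%:R * b ^+ 2 * e * `|k| * p =
            n%:R * (m%:R * (m%:R * b ^+ 2 * `|k|) * e) * p by ring.
  rewrite ler_wpM2r// ler_wpM2l//.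
  by rewrite (le_trans (mulmx_norm_le _ _))// trmx_norm BA ler_wpM2r// ler_wpM2l.
have ple : p <= m%:R * b * `|h - k| + 2 * (m%:R ^+ 2 * n%:R * b ^+ 2 * e * `|k|).
  apply: le_of_sqr_le => //; first by rewrite addr_ge0 ?mulr_ge0 ?exprn_ge0.
  rewrite (le_trans (sqr_norm_le_dot _))// dot_gram dG dotDl dotDl.
  lra.
rewrite split (le_trans (ler_normD _ _))// -/p.
have : `|gB *m (A - B)^T| <= m%:R ^+ 2 * b ^+ 2 * e * `|k|.
  rewrite (le_trans (mulmx_norm_le _ _))// trmx_norm -/e.
  have -> : m%:R ^+ 2 * b ^+ 2 * e * `|k| = m%:R * (m%:R * b ^+ 2 * `|k|) * e by ring.
  by rewrite ler_wpM2r// ler_wpM2l.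
have -> : m%:R ^+ 2 * (2 * n%:R + 1) * b ^+ 2 * e * `|k| =
  2 * (m%:R ^+ 2 * n%:R * b ^+ 2 * e * `|k|) + m%:R ^+ 2 * b ^+ 2 * e * `|k| by ring.
by lra.
Qed.

End LeastNorm.

(** * Comparison of increments, geometric limits, primitives *)

Section Comparison.
Context {R : realType}.

Lemma increment_le (u du v dv : R -> R) (a b : R) : a <= b ->
  (forall t, a <= t <= b -> is_derive t 1 u (du t)) ->
  (forall t, a <= t <= b -> is_derive t 1 v (dv t)) ->
  (forall t, a <= t <= b -> du t <= dv t) -> u b - u a <= v b - v a.
Proof.
move=> ab hu hv huv.
have d t : a <= t <= b -> is_derive t 1 (v - u) (dv t - du t).
  by move=> tab; apply: is_deriveB; [exact: hv|exact: hu].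
have [||c cab] := MVT_segment (f := v - u) (df := fun t => dv t - du t) ab.
- by move=> t; rewrite in_itv/= => /andP[/ltW ? /ltW ?]; apply: d; apply/andP.
- apply: derivable_within_continuous => t; rewrite in_itv/= => /d.
  by move=> h; exact: ex_derive.
move: cab; rewrite in_itv/= => cab h.
have : 0 <= (dv c - du c) * (b - a) by rewrite mulr_ge0 ?subr_ge0 ?huv.
rewrite -h.
have -> : (v - u) b - (v - u) a = (v b - u b) - (v a - u a) by [].
lra.
Qed.

Lemma norm_increment_le (u du v dv : R -> R) (a b : R) : a <= b ->
  (forall t, a <= t <= b -> is_derive t 1 u (du t)) ->
  (forall t, a <= t <= b -> is_derive t 1 v (dv t)) ->
  (forall t, a <= t <= b -> `|du t| <= dv t) -> `|u b - u a| <= v b - v a.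
Proof.
move=> ab hu hv huv; rewrite ler_norml; apply/andP; split.
  rewrite lerNl (_ : - (u b - u a) = (- u) b - (- u) a); last exact: opprD.
  apply: (@increment_le (- u) (fun t => - du t) v dv a b ab) => // t tab.
    by apply: is_deriveN; exact: hu.
  by have := huv t tab; rewrite ler_norml lerNl => /andP[].
by apply: increment_le ab hu hv _ => t tab; exact: (le_trans (ler_norm _) (huv t tab)).
Qed.

Lemma le_geometric (a b c : R) : (forall k, a <= b + c / 2 ^+ k) -> a <= b.
Proof.
move=> h; rewrite leNgt; apply/negP => ba.
have c1 : 0 < `|c| + 1 by rewrite ltr_wpDl.
have e0 : 0 < (a - b) / (`|c| + 1) by rewrite divr_gt0// subr_gt0.
have [k _ /(_ k (leqnn k)) /= hk] := near_infty_natSinv_expn_lt (PosNum e0).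
have k0 : 0 < 2 ^+ k :> R by rewrite exprn_gt0.
have := h k; apply/negP; rewrite -ltNge -ltrBrDl.
apply: (@le_lt_trans _ _ (`|c| / 2 ^+ k)).
  by rewrite ler_wpM2r ?invr_ge0 ?(ltW k0)// ler_norm.
move: hk; rewrite div1r ltr_pdivlMr// => hk.
rewrite (le_lt_trans _ hk)// mulrC ler_wpM2l ?invr_ge0 ?(ltW k0)//.
by rewrite lerDl.
Qed.

(** The sequences [u k - 2 c / 2 ^ k] and [u k + 2 c / 2 ^ k] are monotone and
    enclose the limit. *)
Lemma geometric_limit (u : nat -> R) (c : R) :
  (forall k, `|u k.+1 - u k| <= c / 2 ^+ k) ->
  exists l, forall k, `|u k - l| <= 2 * c / 2 ^+ k.
Proof.
move=> h; pose e k : R := 2 * c / 2 ^+ k.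
have eS k : c / 2 ^+ k = e k - e k.+1.
  by rewrite /e exprS; field; rewrite expf_neq0.
have c0 : 0 <= c by have := le_trans (normr_ge0 _) (h 0%N); rewrite expr0 divr1.
have e0 k : 0 <= e k by rewrite mulr_ge0 ?invr_ge0 ?exprn_ge0// mulr_ge0.
have mono k j : u k - e k <= u (k + j)%N - e (k + j)%N
    /\ u (k + j)%N + e (k + j)%N <= u k + e k.
  elim: j => [|j [h1 h2]]; first by rewrite addn0.
  rewrite addnS; have := h (k + j)%N; rewrite ler_norml eS => /andP[h3 h4].
  by split; lra.
have ub k j : u k - e k <= u j + e j.
  have [kj|/ltnW jk] := leqP k j.
    have [h1 h2] := mono k (j - k)%N; move: h1 h2; rewrite subnKC// => h1 h2.
    by have := e0 j; lra.
  have [h1 h2] := mono j (k - j)%N; move: h1 h2; rewrite subnKC// => h1 h2.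
  by have := e0 k; lra.
pose S := [set u k - e k | k in setT].
exists (sup S) => k; rewrite -/(e k) ler_distl; apply/andP; split.
  rewrite lerBlDr; apply: ge_sup; first by exists (u 0%N - e 0%N), 0%N.
  by move=> _ [j _ <-].
rewrite -lerBlDr; apply: ub_le_sup; last by exists k.
by exists (u 0%N + e 0%N) => _ [j _ <-].
Qed.

(** Integrating from [-1] makes the derivative at [0] two-sided. *)
Lemma primitive (g : R -> R) : continuous g ->
  exists2 G : R -> R, G 0 = 0 & forall t : R, -1 < t -> is_derive t 1 G (g t).
Proof.
move=> cg.
pose F x := (\int[lebesgue_measure]_(t in [set` `[(-1 : R), x]]) g t)%R.
exists (fun x => F x - F 0); first by rewrite subrr.
move=> t t1.
have tt : t < t + 1 by rewrite ltrDl.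
have [||dF FE] := continuous_FTC1_closed tt _ t1 (f := g).
- apply: continuous_compact_integrable; first exact: segment_compact.
  exact: continuous_subspaceT.
- exact: cg.
have -> : g t = g t - 0 by rewrite subr0.
apply: is_deriveB; rewrite -FE derive1E; exact: derivableP.
Qed.

End Comparison.

(** * Curves of row vectors *)

Section Curves.
Context {R : realType} {n : nat}.
Implicit Types (y z : R -> 'rV[R]_n) (W : 'rV[R]_n -> R -> 'rV[R]_n).

Lemma is_derive_rV y (t : R) (w : 'rV[R]_n) :
  is_derive t 1 y w <-> forall i, is_derive t 1 (fun s => y s 0 i) (w 0 i).
Proof.
split=> [h i|h].
  have /derivable_mxP hd : derivable y t 1 by exact: ex_derive.
  apply: DeriveDef; first exact: hd.
  have := @derive_val _ _ _ _ _ _ _ h; rewrite derive_mx; last exact: ex_derive.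
  by move=> <-; rewrite mxE.
have hd : derivable y t 1.
  by apply/derivable_mxP => i j; rewrite (ord1 i); exact: ex_derive.
apply: DeriveDef => //; rewrite derive_mx//; apply/rowP => i.
by rewrite mxE derive_val.
Qed.

Lemma norm_curve_le y (w : R -> 'rV[R]_n) (v dv : R -> R) (a b : R) : a <= b ->
  (forall t, a <= t <= b -> is_derive t 1 y (w t)) ->
  (forall t, a <= t <= b -> is_derive t 1 v (dv t)) ->
  (forall t, a <= t <= b -> `|w t| <= dv t) -> `|y b - y a| <= v b - v a.
Proof.
move=> ab hy hv hw; apply: mx_norm_le => [|i j].
  have -> : 0 = cst (0 : R) b - cst 0 a by rewrite /= subrr.
  apply: (increment_le (du := cst 0) (dv := dv) ab) => // t tab.
  exact: le_trans (hw t tab).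
rewrite (ord1 i) !mxE.
apply: (@norm_increment_le _ (fun s => y s 0 j) (fun s => w s 0 j) v dv a b ab) => //.
  by move=> t tab; have /is_derive_rV := hy t tab; apply.
by move=> t tab; rewrite (le_trans (mx_coord_le _ _ _))// hw.
Qed.

Lemma lipschitz_curve y (w : R -> 'rV[R]_n) (B a b : R) :
  (forall t, a <= t <= b -> is_derive t 1 y (w t)) ->
  (forall t, a <= t <= b -> `|w t| <= B) ->
  forall s t, a <= s <= b -> a <= t <= b -> `|y s - y t| <= B * `|s - t|.
Proof.
move=> hy hw; have main s t : a <= s <= b -> a <= t <= b -> s <= t ->
    `|y t - y s| <= B * (t - s).
  move=> /andP[as_ sb] /andP[at_ tb] st.
  rewrite mulrBr; apply: (@norm_curve_le y w (fun r => B * r) (fun=> B) s t st).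
  - move=> r /andP[sr rt]; apply: hy.
    by rewrite (le_trans as_ sr) (le_trans rt tb).
  - move=> r _; have -> : (fun r : R => B * r) = B *: (id : R -> R) by [].
    by apply: is_derive_eq; rewrite /GRing.scale/= mulr1.
  - move=> r /andP[sr rt]; apply: hw.
    by rewrite (le_trans as_ sr) (le_trans rt tb).
move=> s t hs ht; have [st|/ltW ts] := leP s t.
  by rewrite distrC [`|s - t|]distrC ger0_norm ?subr_ge0// main.
by rewrite [X in B * X]ger0_norm ?subr_ge0// main.
Qed.

Lemma primitive_rV (g : R -> 'rV[R]_n) : continuous g ->
  exists2 G : R -> 'rV[R]_n, G 0 = 0 &
    forall t : R, -1 < t -> is_derive t 1 G (g t).
Proof.
move=> cg.
have hi i : exists G : R -> R, G 0 = 0 /\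
    forall t : R, -1 < t -> is_derive t 1 G (g t 0 i).
  have [|G G0 hG] := @primitive R (fun t => g t 0 i); last by exists G.
  move=> t; apply: (@continuous_comp _ _ _ g (fun A : 'rV_n => A 0 i)).
    exact: cg.
  exact: coord_continuous.
have /choice[G hG] := hi.
exists (fun t => \row_i G i t); first by apply/rowP => i; rewrite !mxE; case: (hG i).
move=> t t1; apply/is_derive_rV => i.
have -> : (fun s => (\row_i G i s) 0 i) = G i by apply/funext => s; rewrite mxE.
by case: (hG i) => _; apply.
Qed.

Definition field_lipschitz (L : R) W := forall (x y : 'rV[R]_n) (s t : R),
  `|W x s - W y t| <= L * (`|x - y| + `|s - t|).

Definition solution W y := forall t : R, 0 <= t <= 1 -> is_derive t 1 y (W (y t) t).

Definition clamp (a b s : R) : R := Num.max a (Num.min s b).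

Lemma clamp_lipschitz (a b s t : R) : `|clamp a b s - clamp a b t| <= `|s - t|.
Proof.
rewrite /clamp; have [|] := leP s b; have [|] := leP t b => h1 h2;
  do ![case: (leP a _) => ?]; case: (ger0P (s - t)) => ?;
  rewrite ?ler_norml; lra.
Qed.

Lemma clamp_bounds (a b s : R) : a <= b -> a <= clamp a b s <= b.
Proof. by move=> ab; rewrite /clamp le_max lexx ge_max ab ge_min lexx orbT. Qed.

Lemma clamp_id (a b s : R) : a <= s <= b -> clamp a b s = s.
Proof. by move=> /andP[as_ sb]; rewrite /clamp (min_idPl sb) (max_idPr as_). Qed.

End Curves.

(** * Flows of Lipschitz fields *)

Lemma expR_ge1 (R : realType) (x : R) : (1 <= expR x) = (0 <= x).
Proof. by rewrite -expR0 ler_expR. Qed.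

Section Flow.
Context {R : realType} {n : nat}.
Implicit Types (x : 'rV[R]_n) (y z : R -> 'rV[R]_n).
Variables (W : 'rV[R]_n -> R -> 'rV[R]_n) (L B : R).
Hypotheses (L_ge0 : 0 <= L) (W_lip : field_lipschitz L W).
Hypothesis (W_le : forall x t, `|W x t| <= B).

Let lip01 y := forall s t : R, 0 <= s <= 1 -> 0 <= t <= 1 ->
  `|y s - y t| <= B * `|s - t|.

Let image_of x y z := z 0 = x /\
  forall t : R, 0 <= t <= 1 -> is_derive t 1 z (W (y t) t).

Let image_lip x y z : image_of x y z -> lip01 z.
Proof. by move=> [_ hz]; apply: (lipschitz_curve hz). Qed.

(** Clamping the time makes the integrand continuous on the whole line although
    [y] is controlled on the unit interval only. *)
Lemma picard_step x y : lip01 y -> exists z, image_of x y z.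
Proof.
move=> hy; pose cl : R -> R := clamp 0 1.
have [|G G0 hG] := @primitive_rV R n (fun s => W (y (cl s)) (cl s)).
  apply: (@lipschitz_continuous _ _ _ _ (L * (B + 1))) => s t.
  rewrite (le_trans (W_lip _ _ _ _))// -mulrA ler_wpM2l// mulrDl mul1r.
  have B0 : 0 <= B by rewrite (le_trans _ (W_le 0 0)).
  rewrite lerD ?clamp_lipschitz// (le_trans (hy _ _ _ _)) ?clamp_bounds//.
  by rewrite ler_wpM2l ?clamp_lipschitz.
exists (cst x + G); split; first by rewrite /= /GRing.add/= G0 addr0.
move=> t /[dup] t01 /andP[t0 t1].
have := hG t (lt_le_trans (ltrN10 _) t0); rewrite /cl clamp_id// => h.
by rewrite -[W _ _]add0r; apply: is_deriveD.
Qed.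

Let is_derive_expL (c t : R) :
  is_derive t 1 (fun s => c * expR (2 * L * s)) (c * (2 * L * expR (2 * L * t))).
Proof.
have -> : (fun s => c * expR (2 * L * s)) = c *: (expR \o ((2 * L) *: id)) by [].
apply: is_derive_eq; rewrite /GRing.scale/= /GRing.scale/=; ring.
Qed.

(** With the weight [expR (2 * L * t)] the Picard map contracts by one half on the
    whole unit interval, whatever the size of [L]. *)
Lemma picard_contraction x y y' z z' c : 0 <= c ->
  image_of x y z -> image_of x y' z' ->
  (forall t : R, 0 <= t <= 1 -> `|y t - y' t| <= c * expR (2 * L * t)) ->
  forall t : R, 0 <= t <= 1 -> `|z t - z' t| <= c / 2 * expR (2 * L * t).
Proof.
move=> c0 [z0 hz] [z'0 hz'] hyy t /andP[t0 t1].
have e0 s : 0 <= expR (2 * L * s) by exact: expR_ge0.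
have -> : z t - z' t = (z - z') t - (z - z') 0.
  transitivity ((z t - z' t) - (z 0 - z' 0)); last by [].
  by rewrite z0 z'0 subrr subr0.
apply: (@le_trans _ _ (c / 2 * expR (2 * L * t) - c / 2 * expR (2 * L * 0))); last first.
  by rewrite gerBl mulr_ge0 ?divr_ge0.
apply: (@norm_curve_le _ _ (z - z') (fun s => W (y s) s - W (y' s) s)
  (fun s => c / 2 * expR (2 * L * s))
  (fun s => c / 2 * (2 * L * expR (2 * L * s))) 0 t t0) => [s|s _|s].
- move=> /andP[s0 st]; have s01 : 0 <= s <= 1 by rewrite s0 (le_trans st t1).
  by apply: is_deriveB; [exact: hz|exact: hz'].
- exact: is_derive_expL.
- move=> /andP[s0 st]; have s01 : 0 <= s <= 1 by rewrite s0 (le_trans st t1).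
  rewrite (le_trans (W_lip _ _ _ _))// subrr normr0 addr0.
  have := ler_wpM2l L_ge0 (hyy s s01) => /le_trans; apply.
  by rewrite le_eqVlt; apply/orP; left; apply/eqP; field.
Qed.

(** The Picard iterates of the constant curve converge geometrically, uniformly
    on the unit interval; the image of the limit under the Picard map is then
    geometrically close to the iterates, hence equal to the limit. *)
Lemma solution_exists x : exists2 y, y 0 = x & solution W y.
Proof.
have hT y : exists z, lip01 y -> image_of x y z.
  have [/(picard_step x)[z hz]|hy] := pselect (lip01 y); first by exists z.
  by exists y.
have /choice[T hTy] := hT.
pose u k := iter k T (cst x).
have ulip k : lip01 (u k).
  elim: k => [|k ih]; last exact: image_lip (hTy _ ih).
  move=> s t _ _; rewrite subrr normr0 mulr_ge0//.
  by rewrite (le_trans _ (W_le 0 0)).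
have uS k : image_of x (u k) (u k.+1) by exact/hTy/ulip.
have B0 : 0 <= B by rewrite (le_trans _ (W_le 0 0)).
have du k (t : R) : 0 <= t <= 1 ->
    `|u k.+1 t - u k t| <= B / 2 ^+ k * expR (2 * L * t).
  elim: k t => [|k ih] t t01.
    rewrite expr0 divr1; have [u0 _] := uS 0%N.
    have -> : u 0%N t = u 1%N 0 by rewrite u0.
    rewrite (le_trans (ulip 1%N t 0 _ _))// ?lexx ?ler01// ler_wpM2l//.
    have /andP[t0 t1] := t01.
    by rewrite subr0 ger0_norm// (le_trans t1)// expR_ge1 !mulr_ge0.
  rewrite exprS invfM [2^-1 * _]mulrC mulrA.
  apply: (picard_contraction _ (uS _) (uS _) ih) => //.
  by rewrite divr_ge0 ?exprn_ge0.
pose c := B * expR (2 * L).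
have duc k (t : R) : 0 <= t <= 1 -> `|u k.+1 t - u k t| <= c / 2 ^+ k.
  move=> /[dup] t01 /andP[t0 t1]; rewrite (le_trans (du _ _ t01))// /c mulrAC.
  rewrite ler_wpM2r ?invr_ge0 ?exprn_ge0// ler_wpM2l// ler_expR.
  by rewrite -[leRHS]mulr1 ler_wpM2l// mulr_ge0.
have hl (t : R) : exists l : 'rV[R]_n,
    0 <= t <= 1 -> forall k, `|u k t - l| <= 2 * c / 2 ^+ k.
  have [t01|] := pselect (0 <= t <= 1); last by exists 0.
  have hi i : exists li : R, forall k, `|u k t 0 i - li| <= 2 * c / 2 ^+ k.
    apply: geometric_limit => k; rewrite (le_trans _ (duc k t t01))//.
    by have := mx_coord_le (u k.+1 t - u k t) 0 i; rewrite !mxE.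
  have /choice[l hl] := hi; exists (\row_i l i) => _ k.
  apply: mx_norm_le => [|i j]; last by rewrite !mxE (ord1 i).
  by rewrite !mulr_ge0 ?expR_ge0 ?invr_ge0 ?exprn_ge0.
have /choice[y hy] := hl.
have ylip : lip01 y.
  move=> s t s01 t01; apply: (@le_geometric _ _ _ (4 * c)) => k.
  have h1 := hy s s01 k; have h2 := hy t t01 k; have h3 := ulip k s t s01 t01.
  have -> : y s - y t = - (u k s - y s) + ((u k s - u k t) + (u k t - y t)).
    by rewrite opprB !subrKA.
  rewrite (le_trans (ler_normD _ _))// normrN.
  have := ler_normD (u k s - u k t) (u k t - y t).
  by rewrite (_ : 4 * c / 2 ^+ k = 2 * c / 2 ^+ k + 2 * c / 2 ^+ k); [lra|ring].
have [z hz] := picard_step x ylip.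
have zy (t : R) : 0 <= t <= 1 -> z t = y t.
  move=> t01; apply/eqP; rewrite -subr_eq0 -normr_le0.
  apply: (@le_geometric _ _ _ (2 * c * expR (2 * L) + 2 * c)) => k.
  have e1 : 1 <= expR (2 * L) by rewrite expR_ge1 mulr_ge0.
  have ck : 0 <= 2 * c / 2 ^+ k.
    by rewrite !mulr_ge0 ?expR_ge0 ?invr_ge0 ?exprn_ge0.
  have h1 : `|z t - u k.+1 t| <= 2 * c / 2 ^+ k / 2 * expR (2 * L * t).
    apply: (picard_contraction ck hz (uS k)) => // s s01.
    rewrite distrC (le_trans (hy s s01 k))// ler_peMr//.
    have /andP[s0 _] := s01.
    by rewrite expR_ge1 !mulr_ge0.
  have h2 := hy t t01 k.+1.
  have h3 : 2 * c / 2 ^+ k.+1 <= 2 * c / 2 ^+ k.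
    rewrite exprS invfM mulrCA [leLHS]mulrC ler_piMr//.
    by rewrite invf_le1// ler1n.
  have h4 : 2 * c / 2 ^+ k / 2 * expR (2 * L * t) <= 2 * c / 2 ^+ k * expR (2 * L).
    move: ck; set X := 2 * c / 2 ^+ k => ck.
    apply: ler_pM; rewrite ?expR_ge0//; [by lra|by lra|].
    rewrite ler_expR -[leRHS]mulr1 ler_wpM2l ?mulr_ge0//.
    by case/andP: t01.
  have -> : z t - y t = (z t - u k.+1 t) + (u k.+1 t - y t) by rewrite addrA subrK.
  rewrite (le_trans (ler_normD _ _))// add0r.
  have -> : (2 * c * expR (2 * L) + 2 * c) / 2 ^+ k =
     2 * c / 2 ^+ k * expR (2 * L) + 2 * c / 2 ^+ k by ring.
  lra.
exists z; first by case: hz.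
by move=> t t01; rewrite zy//; case: hz => _; apply.
Qed.

(** The squared Euclidean distance [q] of two solutions satisfies
    [|q'| <= k q] with [k = 2 n L], so that [q t * expR (- k t)] decreases and
    [q t * expR (k t)] increases: the estimate holds in both time directions. *)
Lemma gronwall y z : solution W y -> solution W z ->
  forall s t : R, 0 <= s <= 1 -> 0 <= t <= 1 ->
  `|y t - z t| <= expR (2 * n%:R * L) * (n%:R + 1) * `|y s - z s|.
Proof.
move=> hy hz; pose k : R := 2 * n%:R * L.
have k0 : 0 <= k by rewrite /k !mulr_ge0.
pose d t : 'rV[R]_n := y t - z t; pose q (t : R) := dot (d t) (d t).
pose v (t : R) : 'rV[R]_n := W (y t) t - W (z t) t.
have qE t : q t = \sum_i d t 0 i ^+ 2.
  by rewrite /q /dot mxE; apply: eq_bigr => i _; rewrite [_^T i 0]mxE.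
have dd (t : R) : 0 <= t <= 1 -> is_derive t 1 d (v t).
  by move=> t01; apply: is_deriveB; [exact: hy|exact: hz].
have dq (t : R) : 0 <= t <= 1 -> is_derive t 1 q (2 * dot (d t) (v t)).
  move=> t01.
  have -> : q = \sum_i (fun s => d s 0 i) ^+ 2.
    by apply/funext => s; rewrite qE fct_sumE.
  have -> : 2 * dot (d t) (v t) = \sum_i (2%:R * (d t 0 i) ^+ 1) *: (v t 0 i : R).
    rewrite /dot mxE mulr_sumr; apply: eq_bigr => i _.
    by rewrite [_^T i 0]mxE expr1 /GRing.scale/= mulrA.
  apply: is_derive_sum => i; apply: is_deriveX.
  by have /is_derive_rV := dd t t01; apply.
have dqle (t : R) : `|2 * dot (d t) (v t)| <= k * q t.
  rewrite normrM ger0_norm// /k -!mulrA ler_wpM2l//.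
  rewrite (le_trans (dot_le _ _))// -!mulrA ler_wpM2l//.
  have hv : `|v t| <= L * `|d t|.
    by rewrite (le_trans (W_lip _ _ _ _))// subrr normr0 addr0.
  have := ler_wpM2l (normr_ge0 (d t)) hv => /le_trans; apply.
  by rewrite mulrCA ler_wpM2l// -expr2 sqr_norm_le_dot.
have de (e t : R) : is_derive t 1 (fun s => expR (e * s)) (e * expR (e * t)).
  have -> : (fun s => expR (e * s)) = expR \o (e *: id) by [].
  by apply: is_derive_eq; rewrite /GRing.scale/=; ring.
have dqe (e t : R) : 0 <= t <= 1 -> is_derive t 1 (fun s => q s * expR (e * s))
    ((2 * dot (d t) (v t) + e * q t) * expR (e * t)).
  move=> t01; have -> : (fun s => q s * expR (e * s)) = q * (fun s => expR (e * s)) by [].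
  have h1 := dq t t01; have h2 := de e t.
  apply: is_derive_eq; rewrite /GRing.scale/=; ring.
have q0 t : 0 <= q t by rewrite qE sumr_ge0// => i _; rewrite sqr_ge0.
have up s t : 0 <= s <= 1 -> 0 <= t <= 1 -> q t <= expR k * q s.
  move=> s01 t01; have /andP[s0 s1] := s01; have /andP[t0 t1] := t01.
  have ek r : 0 <= r <= 1 -> 1 <= expR (k * r) <= expR k.
    move=> /andP[r0 r1]; rewrite expR_ge1 ?mulr_ge0//= ler_expR.
    by rewrite -[leRHS]mulr1 ler_wpM2l.
  have [st|/ltW ts] := leP s t.
    have hh : q t * expR (- k * t) - q s * expR (- k * s) <= cst 0 t - cst (0 : R) s.
      apply: (increment_le (u := fun s => q s * expR (- k * s)) st).
      - by move=> r /andP[sr rt]; apply: dqe; rewrite (le_trans s0 sr) (le_trans rt t1).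
      - move=> r _ /=; rewrite mulNr; apply: mulr_le0_ge0; last exact: expR_ge0.
        by rewrite subr_le0; exact: le_trans (ler_norm _) (dqle r).
    have h2 : q t * expR (- k * t) <= q s.
      have : q s * expR (- k * s) <= q s.
        by rewrite ler_piMr// expR_le1 mulNr oppr_le0 mulr_ge0.
      by move: hh; rewrite /= subrr subr_le0 => h /(le_trans h).
    have := ler_wpM2r (expR_ge0 (k * t)) h2.
    rewrite -mulrA -expRD mulNr addNr expR0 mulr1 => /le_trans; apply.
    by rewrite mulrC ler_wpM2r//; case/andP: (ek t t01).
  have hh : cst 0 s - cst (0 : R) t <= q s * expR (k * s) - q t * expR (k * t).
    apply: (increment_le (u := cst 0) (du := cst 0)
      (v := fun s => q s * expR (k * s)) ts).
    - by move=> r /andP[sr rt]; apply: dqe; rewrite (le_trans t0 sr) (le_trans rt s1).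
    - move=> r _ /=; apply: mulr_ge0; last exact: expR_ge0.
      rewrite -lerBlDr sub0r lerNl.
      by have := dqle r; rewrite ler_norml lerNl => /andP[].
  move: hh; rewrite /= subrr subr_ge0 => hh.
  apply: (@le_trans _ _ (q t * expR (k * t))).
    by rewrite ler_peMr//; case/andP: (ek t t01).
  by rewrite (le_trans hh)// mulrC ler_wpM2r//; case/andP: (ek s s01).
move=> s t s01 t01; rewrite -/(d t) -/(d s) -/k.
have e1 : 1 <= expR k by rewrite expR_ge1.
have n0 : 0 <= n%:R :> R by [].
have rhs0 : 0 <= expR k * (n%:R + 1) * `|d s| by rewrite !mulr_ge0 ?expR_ge0// addr_ge0.
rewrite -(ler_pXn2r (_ : 0 < 2)%N) ?nnegrE//.
rewrite (le_trans (sqr_norm_le_dot _))// (le_trans (up s t s01 t01))//.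
rewrite !exprMn expr2 -!mulrA ler_wpM2l ?expR_ge0//.
have hq : q s <= n%:R * `|d s| ^+ 2.
  by rewrite (le_trans (ler_norm _))// (le_trans (dot_le _ _))// -mulrA expr2.
rewrite (le_trans hq)//.
have -> : expR k * ((n%:R + 1) * ((n%:R + 1) * `|d s| ^+ 2))
  = expR k * (n%:R + 1) ^+ 2 * `|d s| ^+ 2 by ring.
rewrite ler_wpM2r ?exprn_ge0//.
have h1 : (n%:R : R) <= (n%:R + 1) ^+ 2.
  rewrite -subr_ge0 (_ : _ - _ = n%:R ^+ 2 + n%:R + 1); last by ring.
  by rewrite !addr_ge0// exprn_ge0.
by rewrite (le_trans h1)// ler_peMl// exprn_ge0// addr_ge0.
Qed.

End Flow.

(** * From a vector field to an isotopy *)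

Lemma homeo_of_bilipschitz (R : realType) (n : nat) (D : set 'rV[R]_n)
    (h : 'rV[R]_n -> 'rV[R]_n) (k : R) :
  (forall x y, D x -> D y -> `|h x - h y| <= k * `|x - y|) ->
  (forall x y, D x -> D y -> `|x - y| <= k * `|h x - h y|) ->
  homeo_onto_image D h.
Proof.
move=> hup hlo; split; first exact: within_lipschitz_continuous hup.
have hg y : exists x, (h @` D) y -> D x /\ h x = y.
  have [[x Dx <-]|?] := pselect ((h @` D) y); first by exists x.
  by exists 0.
have /choice[g gP] := hg; exists g; split.
  move=> x Dx; have [Dg hgx] := gP (h x) (imageP h Dx).
  apply/eqP; rewrite -subr_eq0 -normr_le0 (le_trans (hlo _ _ Dg Dx))//.
  by rewrite hgx subrr normr0 mulr0.
apply: (@within_lipschitz_continuous _ _ _ _ _ k) => y z hy hz.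
have [Dy ey] := gP y hy; have [Dz ez] := gP z hz.
by rewrite (le_trans (hlo _ _ Dy Dz))// ey ez.
Qed.

Lemma is_derive_comp_curve (R : realType) n m (f : 'rV[R]_n -> 'rV[R]_m)
    (y : R -> 'rV[R]_n) (t : R) (w : 'rV[R]_n) :
  differentiable f (y t) -> is_derive t 1 y w ->
  is_derive t 1 (f \o y) ('d f (y t) w).
Proof.
move=> df dy.
have dyt : differentiable y t by apply/derivable1_diffP; exact: ex_derive.
have dfy : differentiable (f \o y) t by exact: differentiable_comp.
apply: DeriveDef; first exact: diff_derivable.
have <- : 'd y t 1 = w by rewrite -deriveE// derive_val.
by rewrite deriveE// diff_comp.
Qed.

Section FieldToIsotopy.
Context {R : realType} {n m : nat}.
Variables (Z U : set 'rV[R]_n) (f h : 'rV[R]_n -> 'rV[R]_m).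
Variables (W : 'rV[R]_n -> R -> 'rV[R]_n) (r K : R).
Hypotheses (r_gt0 : 0 < r) (K_ge0 : 0 <= K).
Hypothesis cubeU : forall x, `|x| <= r -> U x.
Hypothesis f_diff : forall x, `|x| <= r -> differentiable f x.
Hypothesis h_diff : forall x, `|x| <= r -> differentiable h x.
Hypothesis W_lip : forall x y s t, `|x| <= r -> `|y| <= r ->
  0 <= s <= 1 -> 0 <= t <= 1 -> `|W x s - W y t| <= K * (`|x - y| + `|s - t|).
Hypothesis Z_0 : Z 0.
Hypothesis W_Z : forall x t, `|x| <= r -> 0 <= t <= 1 -> Z x -> W x t = 0.
Hypothesis W_eq : forall x t, `|x| <= r -> 0 <= t <= 1 ->
  'd f x (W x t) + t *: 'd h x (W x t) + h x = 0.

Let cube (x : 'rV[R]_n) : 'rV[R]_n := \row_i clamp (- r) r (x 0 i).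

Let Nr : - r <= r.
Proof. by rewrite (@le_trans _ _ 0)// ?oppr_le0 ltW. Qed.

Let cube_le x : `|cube x| <= r.
Proof.
apply: mx_norm_le => [|i j]; first exact: ltW.
by rewrite mxE ler_norml clamp_bounds.
Qed.

Let cube_lip x y : `|cube x - cube y| <= `|x - y|.
Proof.
apply: mx_norm_le => // i j; rewrite !mxE (le_trans (clamp_lipschitz _ _ _ _))//.
by have := mx_coord_le (x - y) 0 j; rewrite !mxE.
Qed.

Let cube_id x : `|x| <= r -> cube x = x.
Proof.
move=> xr; apply/rowP => i; rewrite mxE clamp_id// -ler_norml.
exact: le_trans (mx_coord_le _ _ _) xr.
Qed.

(** Clamping coordinates and time extends [W] to a bounded, globally Lipschitz
    field, whose solutions starting near [0] do not leave the cube. *)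
Let V x t := W (cube x) (clamp 0 1 t).

Let V_E x t : `|x| <= r -> 0 <= t <= 1 -> V x t = W x t.
Proof. by move=> xr t01; rewrite /V cube_id// clamp_id. Qed.

Let V_lip : field_lipschitz K V.
Proof.
move=> x y s t; rewrite (le_trans (W_lip _ _ _ _)) ?cube_le ?clamp_bounds//.
by rewrite ler_wpM2l// lerD ?cube_lip ?clamp_lipschitz.
Qed.

Let V_le x t : `|V x t| <= K * r.
Proof.
have t01 := clamp_bounds t (ler01 : 0 <= 1 :> R).
have n0 : `|0 : 'rV[R]_n| <= r by rewrite normr0 ltW.
have := W_lip (cube_le x) n0 t01 t01; rewrite (W_Z n0 t01 Z_0) !subr0 subrr.
by rewrite normr0 addr0 => /le_trans; apply; rewrite ler_wpM2l.
Qed.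

(** By the chain rule [W_eq] says that [f + t h] has zero derivative along the
    solutions.  A point of [Z] in the cube is a constant solution, so [gronwall]
    shows that it does not move; comparison with the constant solution [0]
    shows that solutions from the ball of radius [r / k] stay in the cube. *)
Lemma isotopy_of_field : exists (Omega : set 'rV[R]_n) H,
  [/\ isotopy_near Z Omega H, Omega `<=` U,
      forall x t, Omega x -> 0 <= t <= 1 -> U (H x t)
    & forall x t, Omega x -> 0 <= t <= 1 ->
        f (H x t) + t *: h (H x t) = f x].
Proof.
have /choice[H hH] : forall x, exists y, y 0 = x /\ solution V y.
  by move=> x; have [y y0 hy] := solution_exists K_ge0 V_lip V_le x; exists y.
pose k : R := expR (2 * n%:R * K) * (n%:R + 1).
have k_gt0 : 0 < k by rewrite /k mulr_gt0 ?expR_gt0// ltr_wpDl.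
have k_ge1 : 1 <= k.
  by rewrite /k mulr_ege1 ?lerDr// expR_ge1 !mulr_ge0.
have t0 : 0 <= (0 : R) <= 1 by rewrite lexx ler01.
have H0 x : H x 0 = x by case: (hH x).
have Hsol x : solution V (H x) by case: (hH x).
have Hlip x y s t : 0 <= s <= 1 -> 0 <= t <= 1 ->
    `|H x t - H y t| <= k * `|H x s - H y s|.
  exact: (gronwall K_ge0 V_lip (Hsol x) (Hsol y)).
have fixed x : Z x -> `|x| <= r -> forall t, 0 <= t <= 1 -> H x t = x.
  move=> Zx xr t t01; have cx : solution V (cst x).
    by move=> s s01; rewrite V_E// W_Z//; exact: is_derive_cst.
  apply/eqP; rewrite -subr_eq0 -normr_le0.
  have := gronwall K_ge0 V_lip (Hsol x) cx t0 t01.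
  by rewrite /= H0 subrr normr0 mulr0.
have n0 : `|0 : 'rV[R]_n| <= r by rewrite normr0 ltW.
pose Omega := [set x : 'rV[R]_n | `|x| <= r / k].
have Or x : Omega x -> `|x| <= r.
  move=> /le_trans; apply; rewrite ler_pdivrMr// ler_peMr//; exact: ltW.
have stay x t : Omega x -> 0 <= t <= 1 -> `|H x t| <= r.
  rewrite /Omega/= => xO t01; have := Hlip x 0 _ _ t0 t01.
  rewrite (fixed 0 Z_0 n0 t t01) !H0 !subr0 => /le_trans; apply.
  by rewrite mulrC -ler_pdivlMr.
exists Omega, H; split.
- split.
  + apply/nbhs_ballP; exists (r / k); first by rewrite /= divr_gt0.
    by move=> x; rewrite -ball_normE /= sub0r normrN => /ltW.
  + apply: (@within_lipschitz_continuous _ _ _ _ _ (k + K * r)).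
    move=> [x t] [y s] [/= Ox]; rewrite in_itv/= => t01 [/= Oy].
    rewrite in_itv/= => s01.
    have -> : H x t - H y s = (H x t - H y t) + (H y t - H y s) by rewrite subrKA.
    rewrite (le_trans (ler_normD _ _))// mulrDl lerD//.
      rewrite (le_trans (Hlip x y _ _ t0 t01))// !H0 ler_wpM2l ?(ltW k_gt0)//.
      by rewrite [leRHS]prod_normE/= le_max lexx.
    rewrite (@le_trans _ _ (K * r * `|t - s|))//.
      by apply: (lipschitz_curve (Hsol y)) => // u _.
    rewrite ler_wpM2l ?mulr_ge0 ?(ltW r_gt0)//.
    by rewrite [leRHS]prod_normE/= le_max lexx orbT.
  + by [].
  + by move=> x t [Ox Zx]; apply: fixed => //; exact: Or.
  + move=> t t01; apply: (@homeo_of_bilipschitz _ _ _ _ k) => x y Ox Oy.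
      by have := Hlip x y _ _ t0 t01; rewrite !H0.
    by have := Hlip x y _ _ t01 t0; rewrite !H0.
- by move=> x /Or; exact: cubeU.
- by move=> x t Ox t01; apply: cubeU; exact: stay.
move=> x t Ox t01.
pose P (s : R) := f (H x s) + s *: h (H x s).
have dP (s : R) : 0 <= s <= 1 -> is_derive s 1 P 0.
  move=> s01; have Hr := stay x s Ox s01.
  have dH := Hsol x s s01; rewrite V_E// in dH.
  have dfH := is_derive_comp_curve (f_diff Hr) dH.
  have dhH := is_derive_comp_curve (h_diff Hr) dH.
  apply/is_derive_rV => i.
  have -> : (fun u => P u 0 i) =
    (fun u => f (H x u) 0 i) + (id : R -> R) * (fun u => h (H x u) 0 i).
    by apply/funext => u; rewrite /P !mxE.
  have /is_derive_rV/(_ i) d1 := dfH; have /is_derive_rV/(_ i) d2 := dhH.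
  apply: (is_derive_eq (is_deriveD d1 (is_deriveM (is_derive_id s 1) d2))).
  have := W_eq Hr s01 => /rowP/(_ i); rewrite !mxE => <-.
  by rewrite addrA; congr (_ + _); exact: mulr1.
have Pt : `|P t - P 0| <= 0 * `|t - 0|.
  by apply: (lipschitz_curve dP) => // ? _; rewrite normr0.
move: Pt; rewrite mul0r normr_le0 subr_eq0 => /eqP.
by rewrite /P H0 scale0r addr0.
Qed.

End FieldToIsotopy.

(** * The lifting field and its Lipschitz estimate *)

Section FieldEstimate.
Context {R : realType} {n m : nat}.
Variables (A : 'rV[R]_n -> R -> 'M[R]_(n, m)) (h : 'rV[R]_n -> 'rV[R]_m).
Variables (nu : 'rV[R]_n -> R) (r L q G a d : R).
Hypotheses (L_gt0 : 0 < L) (q_ge0 : 0 <= q) (G_ge0 : 0 <= G) (a_ge0 : 0 <= a).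
Hypothesis d_ge0 : 0 <= d.
Hypothesis nu_ge0 : forall x, 0 <= nu x.
Hypothesis nu_lip : forall x y, `|x| <= r -> `|y| <= r ->
  nu x <= nu y + L * `|x - y|.
Hypothesis A_coer : forall x t, `|x| <= r -> 0 <= t <= 1 -> 0 < nu x ->
  coercive (q / nu x) (A x t).
Hypothesis A_lip : forall x y s t, `|x| <= r -> `|y| <= r ->
  0 <= s <= 1 -> 0 <= t <= 1 -> `|A x s - A y t| <= G * (`|x - y| + `|s - t|).
Hypothesis h_le : forall x, `|x| <= r -> `|h x| <= a * nu x ^+ 2.
Hypothesis h_lip : forall x y, `|x| <= r -> `|y| <= r ->
  `|h x - h y| <= d * (nu x + L * `|x - y|) * `|x - y|.

(** Where [nu] vanishes so does [h], and the value [0] both solves the equation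
    and agrees with the bound of the field by a multiple of [nu]. *)
Definition lifting_field x t : 'rV[R]_n := if nu x == 0 then 0 else - lnsol (A x t) (h x).

Lemma lifting_field_eq x t : `|x| <= r -> 0 <= t <= 1 ->
  lifting_field x t *m A x t + h x = 0.
Proof.
move=> xr t01; rewrite /lifting_field; case: eqVneq => [nux|nux].
  rewrite mul0mx add0r; apply/eqP; rewrite -normr_le0 (le_trans (h_le xr))//.
  by rewrite nux expr0n mulr0.
rewrite mulNmx (lnsolK _ (A_coer xr t01 _)) ?addNr//.
by rewrite lt_def nux nu_ge0.
Qed.

Lemma lifting_field_le x t : `|x| <= r -> 0 <= t <= 1 ->
  `|lifting_field x t| <= m%:R * q * a * nu x.
Proof.
move=> xr t01; rewrite /lifting_field; case: eqVneq => [->|nux].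
  by rewrite normr0 mulr0.
have nx : 0 < nu x by rewrite lt_def nux nu_ge0.
have b0 : 0 <= q / nu x by rewrite divr_ge0.
rewrite normrN (le_trans (lnsol_le _ b0 (A_coer xr t01 nx)))//.
have -> : m%:R * q * a * nu x = m%:R * (q / nu x) * (a * nu x ^+ 2).
  by field; rewrite gt_eqF.
apply: ler_wpM2l; last exact: h_le.
by apply: mulr_ge0.
Qed.

Lemma coercive_le b b' (B : 'M[R]_(n, m)) : b <= b' -> coercive b B -> coercive b' B.
Proof. by move=> bb hB g; rewrite (le_trans (hB g))// ler_wpM2r. Qed.

Let K : R := 3 * m%:R * q * d + 9 * m%:R ^+ 2 * (2 * n%:R + 1) * q ^+ 2 * G * a
  + 5 * m%:R * q * a * L.

Let K_ge0 : 0 <= K.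
Proof.
have m0 : 0 <= m%:R :> R by []. have n0 : 0 <= n%:R :> R by [].
have L0 := ltW L_gt0.
by rewrite /K !addr_ge0 // ?(mulr_ge0, exprn_ge0, addr_ge0).
Qed.

(** When [y] is close to [x] compared with [nu x], both maps are coercive with a
    constant of order [1 / nu x], and the factors [nu x] in the bounds on [h] and
    on its increments cancel it; otherwise both values of the field are bounded
    by a multiple of the distance. *)
Lemma lifting_field_lipschitz : exists2 K, 0 <= K &
  forall x y s t, `|x| <= r -> `|y| <= r ->
  0 <= s <= 1 -> 0 <= t <= 1 ->
  `|lifting_field x s - lifting_field y t| <= K * (`|x - y| + `|s - t|).
Proof.
exists K => // x y s t xr yr s01 t01.
have m0 : 0 <= m%:R :> R by []. have n0 : 0 <= n%:R :> R by [].
set D := `|x - y| + `|s - t|; have xyD : `|x - y| <= D by rewrite lerDl.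
have D0 : 0 <= D by rewrite addr_ge0.
have nyx : nu y <= nu x + L * `|x - y| by rewrite distrC nu_lip.
have nxy := nu_lip xr yr.
have LD : L * `|x - y| <= L * D by rewrite ler_wpM2l// ltW.
(* The factor 2 makes [nu y] lie between [nu x / 2] and [3 / 2 * nu x]. *)
have [near|far] := leP (2 * L * `|x - y|) (nu x); last first.
  have := lifting_field_le xr s01; have := lifting_field_le yr t01 => hy hx.
  rewrite (le_trans (ler_normB _ _))//.
  have w0 : 0 <= m%:R * q * a by rewrite !mulr_ge0.
  apply: (@le_trans _ _ (5 * m%:R * q * a * L * D)).
    have h1 : nu x + nu y <= 5 * (L * D) by lra.
    have := ler_wpM2l w0 h1; lra.
  rewrite ler_wpM2r// /K lerDr.
  by rewrite !addr_ge0 // ?(mulr_ge0, exprn_ge0, addr_ge0).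
have [nx0|nx] := eqVneq (nu x) 0.
  have xy0 : `|x - y| = 0.
    apply/eqP; rewrite eq_le normr_ge0 andbT -(ler_pM2l L_gt0) mulr0.
    by move: near; rewrite nx0; lra.
  have ny0 : nu y = 0.
    by apply/eqP; rewrite eq_le nu_ge0 andbT (le_trans nyx)// nx0 xy0 mulr0 addr0.
  by rewrite /lifting_field nx0 ny0 eqxx subrr normr0 mulr_ge0.
have nxp : 0 < nu x by rewrite lt_def nx nu_ge0.
have nyp : nu x / 2 <= nu y by lra.
have ny0 : 0 < nu y by rewrite (lt_le_trans _ nyp)// divr_gt0.
have ny2 : nu y <= 3 / 2 * nu x by lra.
rewrite /lifting_field (gt_eqF nxp) (gt_eqF ny0) opprK addrC distrC.
set b := 2 * q / nu x.
have b0 : 0 <= b by rewrite /b divr_ge0// mulr_ge0.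
have cx : coercive b (A x s).
  apply: coercive_le (A_coer xr s01 nxp).
  by rewrite /b -mulrA ler_peMl ?divr_ge0// ler1n.
have cy : coercive b (A y t).
  apply: coercive_le (A_coer yr t01 ny0).
  have -> : b = q * (nu x / 2)^-1 by rewrite /b invf_div; ring.
  by rewrite ler_wpM2l// lef_pV2 ?posrE ?divr_gt0.
rewrite (le_trans (lnsol_diff _ _ b0 cx cy))//.
have h1 : m%:R * b * `|h x - h y| <= 3 * m%:R * q * d * D.
  apply: (@le_trans _ _ (m%:R * b * (d * (3 / 2 * nu x) * D))).
    apply: ler_wpM2l; first by apply: mulr_ge0.
    rewrite (le_trans (h_lip xr yr))//.
    have h0 : nu x + L * `|x - y| <= 3 / 2 * nu x by lra.
    apply: ler_pM => //; last by rewrite ler_wpM2l.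
    by rewrite !mulr_ge0// addr_ge0// mulr_ge0// ltW.
  rewrite le_eqVlt; apply/orP; left; apply/eqP; rewrite /b; field.
  by rewrite gt_eqF.
have h2 : m%:R ^+ 2 * (2 * n%:R + 1) * b ^+ 2 * `|A x s - A y t| * `|h y|
    <= 9 * m%:R ^+ 2 * (2 * n%:R + 1) * q ^+ 2 * G * a * D.
  apply: (@le_trans _ _ (m%:R ^+ 2 * (2 * n%:R + 1) * b ^+ 2 * (G * D)
      * (a * (3 / 2 * nu x) ^+ 2))).
    have cst0 : 0 <= m%:R ^+ 2 * (2 * n%:R + 1) * b ^+ 2 :> R.
      have c2 : 0 <= 2 * n%:R + 1 :> R by lra.
      apply: mulr_ge0; last exact: exprn_ge0.
      by apply: mulr_ge0 => //; exact: exprn_ge0.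
    apply: ler_pM => //; first by apply: mulr_ge0.
      by apply: ler_wpM2l => //; exact: A_lip.
    rewrite (le_trans (h_le yr))//; apply: ler_wpM2l => //.
    by rewrite ler_pXn2r ?nnegrE// mulr_ge0// ltW.
  rewrite le_eqVlt; apply/orP; left; apply/eqP; rewrite /b; field.
  by rewrite gt_eqF.
have h3 : 0 <= 5 * m%:R * q * a * L * D by rewrite !mulr_ge0// ltW.
rewrite /K; lra.
Qed.

End FieldEstimate.

(** * Triviality of the deformation *)

Lemma segment_increment_le (R : realType) n m (f : 'rV[R]_n -> 'rV[R]_m)
    (r B : R) x y : `|x| <= r -> `|y| <= r ->
  (forall z, `|z| <= r -> differentiable f z) ->
  (forall z, `|z| <= r -> `|x - z| <= `|x - y| -> `|'d f z (x - y)| <= B) ->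
  `|f x - f y| <= B.
Proof.
move=> xr yr fd fB; pose z (s : R) := y + s *: (x - y).
have dz (s : R) : is_derive s 1 z (x - y).
  apply/is_derive_rV => i.
  have -> : (fun u => z u 0 i) = cst (y 0 i) + (id : R -> R) * cst ((x - y) 0 i).
    by apply/funext => u; rewrite /z mxE [X in _ + X]mxE.
  apply: (is_derive_eq (is_deriveD (is_derive_cst _ _ _)
    (is_deriveM (is_derive_id s 1) (is_derive_cst _ _ _)))).
  by rewrite add0r scaler0 add0r; exact: mulr1.
have zr (s : R) : 0 <= s <= 1 -> `|z s| <= r.
  move=> /andP[s0 s1]; have -> : z s = (1 - s) *: y + s *: x.
    by rewrite /z scalerBr scalerBl scale1r addrA addrAC.
  rewrite (le_trans (ler_normD _ _))// !normrZ !ger0_norm ?subr_ge0//.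
  have := ler_wpM2l s0 xr; have s1' : 0 <= 1 - s by rewrite subr_ge0.
  have := ler_wpM2l s1' yr; lra.
have xz (s : R) : 0 <= s <= 1 -> `|x - z s| <= `|x - y|.
  move=> /andP[s0 s1]; have -> : x - z s = (1 - s) *: (x - y).
    by rewrite /z scalerBl scale1r opprD addrA.
  by rewrite normrZ ger0_norm ?subr_ge0// ler_piMl// gerBl.
have dfz (s : R) : 0 <= s <= 1 -> is_derive s 1 (f \o z) ('d f (z s) (x - y)).
  by move=> s01; apply: is_derive_comp_curve => //; exact/fd/zr.
have := lipschitz_curve (B := B) dfz.
have h01 : 0 <= (0 : R) <= 1 by rewrite lexx ler01.
have h11 : 0 <= (1 : R) <= 1 by rewrite lexx ler01.
move=> /(_ (fun s s01 => fB _ (zr s s01) (xz s s01)) 1 0 h11 h01).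
by rewrite /= /z scale1r scale0r addr0 [y + _]addrC subrK subr0 normr1 mulr1.
Qed.

Theorem corollary1 (R : realType) (n m : nat)
    (N : 'rV[R]_n -> R) (M : 'rV[R]_m -> R)
    (N_norm : is_norm N) (M_norm : is_norm M)
    (U U1 : set 'rV[R]_n) (f f1 : 'rV[R]_n -> 'rV[R]_m)
    (U_open : open U) (U_0 : U 0) (U1_open : open U1) (U1_0 : U1 0)
    (f_0 : f 0 = 0) (f1_0 : f1 0 = 0)
    (f_diff : forall x, U x -> differentiable f x)
    (f1_diff : forall x, U1 x -> differentiable f1 x)
    (df_lip : locally_lipschitz_diff N M U f)
    (df1_lip : locally_lipschitz_diff N M U1 f1)
    (Z : set 'rV[R]_n)
    (Z_def : Z = [set x | U x /\ rabier N M ('d f x) = 0])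
    (Z_0 : Z 0)
    (C C1 C2 : R) (C_gt0 : 0 < C) (C1_gt0 : 0 < C1) (C2_gt0 : 0 < C2)
    (C2_lt : C2 < 2^-1)
    (nu_dist : \forall x \near (0 : 'rV[R]_n),
       C * dist N x Z <= rabier N M ('d f x))
    (f_close : \forall x \near (0 : 'rV[R]_n),
       M (f x - f1 x) <= C1 * rabier N M ('d f x) ^+ 2)
    (df_close : \forall x \near (0 : 'rV[R]_n),
       opnorm N M (fun v => 'd f x v - 'd f1 x v)
         <= C2 * rabier N M ('d f x)) :
  topologically_trivial_near Z U f (U `&` U1) (fun x => f1 x - f x) /\
  isotopical_near Z U f U1 f1.
Proof.
have matrix_of (g : 'rV[R]_n -> 'rV[R]_m) :
    exists D : 'rV[R]_n -> 'M[R]_(n, m), forall x v, 'd g x v = v *m D x.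
  by exists (fun x => lin1_mx ('d g x)) => x v; rewrite mul_rV_lin1.
have [D dfv] := matrix_of f; have [D1 df1v] := matrix_of f1.
pose nu x := rabier N M ('d f x).
have dfE x : 'd f x = mulmxr (D x) :> (_ -> _).
  by apply/funext => v; exact: dfv.
have dBE x y v : 'd f x v - 'd f y v = v *m (D x - D y).
  by rewrite mulmxBr -dfv -dfv.
have d1BE x y v : 'd f1 x v - 'd f1 y v = v *m (D1 x - D1 y).
  by rewrite mulmxBr -df1v -df1v.
have dB1E x v : 'd f x v - 'd f1 x v = v *m (D x - D1 x).
  by rewrite mulmxBr -dfv -df1v.
have nuE x : nu x = rabier N M (mulmxr (D x)) by rewrite /nu dfE.
have nu0 x : 0 <= nu x by rewrite nuE rabier_ge0.
have [bN bN0 hbN] := norm_le_max N_norm.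
have [p p0 hp] := max_le_norm M_norm.
have [kap kap0 hkap] := @max_le_opnorm_mulmxr R n m N M N_norm M_norm.
have [c c0 hc] := @rabier_coercive R n m N M N_norm M_norm.
have [L0 [V [V0 hV]]] := df_lip 0 U_0; have [L1 [V1 [V10 hV1]]] := df1_lip 0 U1_0.
have [e /= e0 he] : exists2 e : R, 0 < e & forall x, `|x| <= e ->
    [/\ U x, U1 x, V x /\ V1 x, M (f x - f1 x) <= C1 * nu x ^+ 2 &
      opnorm N M (mulmxr (D x - D1 x)) <= C2 * nu x].
  have : \forall x \near (0 : 'rV[R]_n),
    [/\ U x, U1 x, V x /\ V1 x, M (f x - f1 x) <= C1 * nu x ^+ 2 &
      opnorm N M (mulmxr (D x - D1 x)) <= C2 * nu x].
    near=> x; split.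
    - by near: x; exact: open_nbhs_nbhs.
    - by near: x; exact: open_nbhs_nbhs.
    - by split; near: x.
    - by near: x.
    - have -> : mulmxr (D x - D1 x) = (fun v => 'd f x v - 'd f1 x v) :> (_ -> _).
        by apply/funext => v; exact/esym/dB1E.
      by near: x.
  move=> /nbhs_ballP[e /= e0 he]; exists (e / 2); first by rewrite divr_gt0.
  move=> x xe; apply: he; rewrite -ball_normE /= sub0r normrN.
  by rewrite (le_lt_trans xe)// ltr_pdivrMr// ltr_pMr// ltr1n.
(* [L0] and [L1] may be negative; the summand 1 makes [L] positive. *)
pose L := (`|L0| + `|L1|) * bN + 1.
have L_gt0 : 0 < L by rewrite /L ltr_wpDl// mulr_ge0 ?addr_ge0// ltW.
have lipD x y : `|x| <= e -> `|y| <= e ->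
    opnorm N M (mulmxr (D x - D y)) <= L * `|x - y|.
  move=> /he[_ _ [Vx _] _ _] /he[_ _ [Vy _] _ _].
  have -> : mulmxr (D x - D y) = (fun v => 'd f x v - 'd f y v) :> (_ -> _).
    by apply/funext => v; exact/esym/dBE.
  rewrite (le_trans (hV _ _ Vx Vy))//.
  rewrite (@le_trans _ _ (`|L0| * N (x - y)))//.
    by rewrite ler_wpM2r ?ler_norm// is_norm_ge0.
  rewrite (@le_trans _ _ (`|L0| * (bN * `|x - y|)))//; first by rewrite ler_wpM2l.
  rewrite mulrA ler_wpM2r// /L mulrDl -addrA lerDl addr_ge0// mulr_ge0//.
  exact: ltW.
have lipD1 x y : `|x| <= e -> `|y| <= e ->
    opnorm N M (mulmxr (D1 x - D1 y)) <= L * `|x - y|.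
  move=> /he[_ _ [_ Vx] _ _] /he[_ _ [_ Vy] _ _].
  have -> : mulmxr (D1 x - D1 y) = (fun v => 'd f1 x v - 'd f1 y v) :> (_ -> _).
    by apply/funext => v; exact/esym/d1BE.
  rewrite (le_trans (hV1 _ _ Vx Vy))//.
  rewrite (@le_trans _ _ (`|L1| * N (x - y)))//.
    by rewrite ler_wpM2r ?ler_norm// is_norm_ge0.
  rewrite (@le_trans _ _ (`|L1| * (bN * `|x - y|)))//; first by rewrite ler_wpM2l.
  rewrite mulrA ler_wpM2r// /L mulrDl addrAC lerDr addr_ge0// mulr_ge0//.
  exact: ltW.
have nu_lip x y : `|x| <= e -> `|y| <= e -> nu x <= nu y + L * `|x - y|.
  move=> xe ye; rewrite !nuE (le_trans (rabier_lipschitz N_norm M_norm _ (D y)))//.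
  by rewrite lerD2l lipD.
pose A x (t : R) := D x + t *: (D1 x - D x).
pose h x := f1 x - f x.
have D1D x : `|x| <= e -> `|D1 x - D x| <= kap * C2 * nu x.
  move=> /he[_ _ _ _ hx]; rewrite distrC (le_trans (hkap _))// -mulrA.
  by rewrite ler_wpM2l// ltW.
(* The total perturbation costs at most [C2 * nu x], hence less than half of
   [nu x], which is where the 2 in the constant comes from. *)
have A_coer x t : `|x| <= e -> 0 <= t <= 1 -> 0 < nu x ->
    coercive (2 / c / nu x) (A x t).
  move=> xe /andP[t0 t1] nx g; rewrite -ler_pdivrMl ?divr_gt0//.
  rewrite (le_trans _ (hc _ _))// ler_wpM2r//.
  have hA : nu x <= rabier N M (mulmxr (A x t)) + C2 * nu x.
    rewrite {1}nuE (le_trans (rabier_lipschitz N_norm M_norm _ (A x t)))// lerD2l.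
    have -> : D x - A x t = t *: (D x - D1 x).
      by rewrite /A opprD addrA subrr sub0r -scalerN opprB.
    rewrite (le_trans (opnorm_mulmxrZ N_norm M_norm _ _))// ger0_norm//.
    have [_ _ _ _ hx] := he x xe; rewrite (le_trans _ hx)// ler_piMl//.
    exact: opnorm_mulmxr_ge0.
  have h2 : C2 * nu x <= 2^-1 * nu x by rewrite ler_wpM2r// ltW.
  have h3 : nu x / 2 <= rabier N M (mulmxr (A x t)) by lra.
  apply: (le_trans _ (ler_wpM2l (ltW c0) h3)).
  rewrite le_eqVlt; apply/orP; left; apply/eqP; field.
  by rewrite !gt_eqF.
have n0 : `|0 : 'rV[R]_n| <= e by rewrite normr0 ltW.
have nu_0 : nu 0 = 0 by move: Z_0; rewrite Z_def => -[].
(* In the time direction [A] varies at most by a multiple of [nu], which is at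
   most [L * e] on the cube because [nu] vanishes at 0. *)
pose G := 2 * kap * L + kap * C2 * (L * e).
have G_ge0 : 0 <= G.
  by rewrite /G addr_ge0// !mulr_ge0// ltW.
have A_lip x y s t : `|x| <= e -> `|y| <= e -> 0 <= s <= 1 -> 0 <= t <= 1 ->
    `|A x s - A y t| <= G * (`|x - y| + `|s - t|).
  move=> xe ye /andP[s0 s1] _.
  have -> : A x s - A y t =
      (1 - s) *: (D x - D y) + (s *: (D1 x - D1 y) + (s - t) *: (D1 y - D y)).
    apply/matrixP => i j; rewrite !mxE; ring.
  have i1 : `|(1 - s) *: (D x - D y)| <= kap * (L * `|x - y|).
    rewrite normrZ ger0_norm ?subr_ge0// (@le_trans _ _ `|D x - D y|)//.
      by rewrite ler_piMl// gerBl.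
    by rewrite (le_trans (hkap _))// ler_wpM2l ?(ltW kap0)// lipD.
  have i2 : `|s *: (D1 x - D1 y)| <= kap * (L * `|x - y|).
    rewrite normrZ ger0_norm// (@le_trans _ _ `|D1 x - D1 y|)//.
      by rewrite ler_piMl.
    by rewrite (le_trans (hkap _))// ler_wpM2l ?(ltW kap0)// lipD1.
  have i3 : `|(s - t) *: (D1 y - D y)| <= kap * C2 * (L * e) * `|s - t|.
    rewrite normrZ mulrC ler_wpM2r// (le_trans (D1D y ye))//.
    rewrite ler_wpM2l ?mulr_ge0 ?(ltW kap0) ?(ltW C2_gt0)//.
    rewrite (le_trans (nu_lip y 0 ye n0))// nu_0 add0r subr0 ler_wpM2l//.
    exact: ltW.
  rewrite (le_trans (ler_normD _ _))//.
  have := ler_normD (s *: (D1 x - D1 y)) ((s - t) *: (D1 y - D y)).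
  have j1 : 0 <= kap * C2 * (L * e) * `|x - y| by rewrite !mulr_ge0// ltW.
  have j2 : 0 <= kap * L * `|s - t| by rewrite !mulr_ge0// ltW.
  rewrite /G; lra.
pose a := p * C1; have a_ge0 : 0 <= a by rewrite mulr_ge0// ltW.
have h_le x : `|x| <= e -> `|h x| <= a * nu x ^+ 2.
  move=> /he[_ _ _ hx _]; rewrite /h distrC (le_trans (hp _))// /a -mulrA.
  by rewrite ler_wpM2l// ltW.
have fD x : `|x| <= e -> differentiable f x by move=> /he[? _ _ _ _]; exact: f_diff.
have f1D x : `|x| <= e -> differentiable f1 x.
  by move=> /he[_ ? _ _ _]; exact: f1_diff.
have hD x : `|x| <= e -> differentiable h x.
  by move=> xe; apply: differentiableB; [exact: f1D|exact: fD].
have dhE x v : `|x| <= e -> 'd h x v = v *m (D1 x - D x).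
  move=> xe; have -> : h = f1 - f by [].
  rewrite diffB; [|exact: f1D|exact: fD].
  by rewrite mulmxBr -dfv -df1v.
pose d := n%:R * kap * C2.
have d_ge0 : 0 <= d by rewrite !mulr_ge0// ltW.
have h_lip x y : `|x| <= e -> `|y| <= e ->
    `|h x - h y| <= d * (nu x + L * `|x - y|) * `|x - y|.
  move=> xe ye; apply: (segment_increment_le xe ye hD) => z ze xz.
  rewrite dhE// (le_trans (mulmx_norm_le _ _))// mulrAC ler_wpM2r//.
  rewrite /d -2!mulrA ler_wpM2l// (le_trans (D1D z ze))//.
  rewrite mulrA ler_wpM2l ?mulr_ge0 ?(ltW kap0) ?(ltW C2_gt0)//.
  rewrite (le_trans (nu_lip z x ze xe))// lerD2l ler_wpM2l ?(ltW L_gt0)//.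
  by rewrite distrC.
have q_ge0 : 0 <= 2 / c by rewrite divr_ge0// ltW.
pose W := lifting_field A h nu.
have [K K_ge0 W_lip] := lifting_field_lipschitz L_gt0 q_ge0 G_ge0 a_ge0 d_ge0 nu0 nu_lip
  A_coer A_lip h_le h_lip.
have W_eq := lifting_field_eq nu0 A_coer h_le.
have W_Z x : Z x -> forall t, W x t = 0.
  by rewrite Z_def => -[_ nux] t; rewrite /W /lifting_field /nu nux eqxx.
split.
  have [|||Om [H [iso OU HU cons]]] := @isotopy_of_field R n m Z (U `&` U1) f h
    W e K e0 K_ge0 _ fD hD W_lip Z_0.
  - by move=> x /he[].
  - by move=> x t _ _ /W_Z.
  - move=> x t xe t01; rewrite -(W_eq x t xe t01) mulmxDr -scalemxAr.
    exact: (congr2 (fun u v => u + t *: v + h x) (dfv x _) (dhE x _ xe)).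
  exists Om, H; split => //.
  - by move=> x Ox; split; [case: (OU x Ox)|exact: OU].
  - by move=> x t Ox t01; have [? ?] := HU x t Ox t01.
  - by move=> x t s Ox t01 s01; rewrite (cons x t Ox t01) (cons x s Ox s01).
(* The same field run backwards in time deforms [f1] into [f]. *)
have rev (s : R) : 0 <= s <= 1 -> 0 <= 1 - s <= 1.
  by move=> /andP[s0 s1]; rewrite subr_ge0 s1 gerBl.
have [|x xe|x y s t xe ye s01 t01|x t xe t01 Zx|x t xe t01|
    Om [H [iso OU HU cons]]] :=
  @isotopy_of_field R n m Z (U `&` U1) f1 (- h) (fun x s => - W x (1 - s)) e K
    e0 K_ge0 _ f1D _ _ Z_0.
- by move=> x /he[].
- by apply: differentiableN; exact: hD.
- have -> : - W x (1 - s) - - W y (1 - t) = - (W x (1 - s) - W y (1 - t)).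
    by rewrite opprB opprK addrC.
  have -> : s - t = - ((1 - s) - (1 - t)) by ring.
  by rewrite !normrN; apply: W_lip => //; exact: rev.
- by rewrite W_Z// oppr0.
- transitivity (- (W x (1 - t) *m A x (1 - t) + h x)); last first.
    by rewrite /W W_eq ?oppr0//; exact: rev.
  have -> : A x (1 - t) = D1 x - t *: (D1 x - D x).
    by rewrite /A scalerBl scale1r addrA [D x + _]addrC subrK.
  have dNh : 'd (- h) x (- W x (1 - t)) = W x (1 - t) *m (D1 x - D x).
    apply: etrans (_ : - 'd h x (- W x (1 - t)) = _).
      exact: (congr1 (fun k : _ -> _ => k (- W x (1 - t))) (diffN (hD x xe))).
    apply: etrans (congr1 -%R (linearN _ _)) _.
    by apply: etrans (opprK _) _; exact: dhE.
  apply: etrans (congr2 (fun u v => u + t *: v + (- h) x) (df1v x _) dNh) _.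
  have -> : W x (1 - t) *m (D1 x - t *: (D1 x - D x)) =
      W x (1 - t) *m D1 x - t *: (W x (1 - t) *m (D1 x - D x)).
    by rewrite [LHS]mulmxBr -scalemxAr.
  have gen (p1 p2 p3 : 'rV[R]_m) : - p1 + p2 - p3 = - (p1 - p2 + p3).
    by rewrite opprD opprB [p2 - p1]addrC.
  by rewrite mulNmx; exact: gen.
have i1 : 0 <= (1 : R) <= 1 by rewrite ler01 lexx.
exists Om, H; split => //.
- by move=> x Ox; have [? ?] := HU x 1 Ox i1.
move=> x Ox; rewrite -(cons x 1 Ox i1) scale1r.
have -> : (- h) (H x 1) = f (H x 1) - f1 (H x 1) by exact: opprB.
by rewrite addrC subrK.
Unshelve. all: by end_near.
Qed.
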